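(* Let $P\subseteq\mathbb{R}^d$ be a $d$-dimensional lattice polytope, let $C\subseteq\mathbb{R}^{d+1}$ be the cone over $P$, and let $\Gamma_P$ be the sublattice of $\mathbb{Z}^{d+1}$ spanned by the lattice points in $\{1\}\times P$. Then for every $\mathbf{v}\in\mathbb{Z}^{d+1}$ there exist nonnegative integers $a_{\mathbf{v}} \le b_{\mathbf{v}}$ such that for every pair $(\mathcal{T}_0,\xi_0)\in\Upsilon_C\times\Xi_C$, \[ [a_{\mathbf{v}}, b_{\mathbf{v}}]\cap\mathbb{Z} = h^*_{\mathcal{T}_0,\xi_0}\bigl(C\cap(\mathbf{v}+\Gamma_P)\bigr). \]
   Context: The cone over $P$ is $C=\mathrm{cone}(\{1\}\times P)\subseteq\mathbb{R}^{d+1}$. $\Upsilon_C$ is the set of triangulations $\mathcal{T}$ of $C$, where a triangulation means a regular triangulation of $C$ into simplicial cones such that the primitive ray generators of every cone of the triangulation lie in $\{1\}\times\mathbb{R}^d$ (they are then lattice points of $\{1\}\times P$); $\mathcal{T}^{(k)}$ denotes its set of $k$-dimensional cones, and for a cone $\sigma$, $\sigma^{(1)}$ denotes the set of primitive generators in $\mathbb{Z}^{d+1}$ of its extremal rays. A point $\xi$ is generic with respect to $\mathcal{T}$ if it lies in none of the linear subspaces spanned by cones in $\mathcal{T}^{(d)}$; $\Xi_C$ is the set of $\xi\in C$ generic with respect to every $\mathcal{T}\in\Upsilon_C$. For $\sigma\in\mathcal{T}^{(d+1)}$ and $\xi\in\Xi_C$, write $\xi=\sum_{\mathbf{w}\in\sigma^{(1)}}\lambda_{\mathbf{w}}\mathbf{w}$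 (all $\lambda_{\mathbf{w}}\ne0$), let $I_\xi(\sigma)=\{\mathbf{w}\in\sigma^{(1)}:\lambda_{\mathbf{w}}<0\}$, let the half-open cell be $\sigma[\xi)=\{\sum_{\mathbf{w}}\mu_{\mathbf{w}}\mathbf{w}:\mu_{\mathbf{w}}\ge0,\ \mu_{\mathbf{w}}>0 \text{ for } \mathbf{w}\in I_\xi(\sigma)\}$, and the half-open parallelepiped $\Pi_\sigma[\xi)=\{\sum_{\mathbf{w}}\lambda_{\mathbf{w}}\mathbf{w}: \lambda_{\mathbf{w}}\in[0,1) \text{ for } \mathbf{w}\notin I_\xi(\sigma),\ \lambda_{\mathbf{w}}\in(0,1] \text{ for } \mathbf{w}\in I_\xi(\sigma)\}$. The half-open cells $\sigma[\xi)$, $\sigma\in\mathcal{T}^{(d+1)}$, partition $C$. For $\mathbf{x}\in C\cap\mathbb{Z}^{d+1}$, let $\sigma$ be the unique cell with $\mathbf{x}\in\sigma[\xi)$, and let $\{\mathbf{x}\}_{\mathcal{T},\xi}$ be the unique point of $\Pi_\sigma[\xi)\cap\mathbb{Z}^{d+1}$ with $\mathbf{x}-\{\mathbf{x}\}_{\mathcal{T},\xi}\in\sum_{\mathbf{w}\in\sigma^{(1)}}\mathbb{Z}_{\ge0}\mathbf{w}$; then $h^*_{\mathcal{T},\xi}(\mathbf{x})$ is defined as the first coordinate of $\{\mathbf{x}\}_{\mathcal{T},\xi}$. For a set $S$, $h^*_{\mathcal{T},\xi}(S)$ denotes the image set. *)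

(* Defs.v *)
From HB Require Import structures.
From mathcomp Require Import all_boot all_order all_algebra.
From mathcomp Require Import boolp classical_sets functions cardinality.
From mathcomp Require Import fsbigop set_interval reals convex.

Set Implicit Arguments.
Unset Strict Implicit.
Unset Printing Implicit Defensive.

Import Order.TTheory GRing.Theory Num.Theory.
Local Open Scope classical_set_scope.
Local Open Scope ring_scope.

Section Convexity.
Variables (R : realType) (n : nat).
Implicit Types (S F s : set 'rV[R]_n) (u w x : 'rV[R]_n).

Definition lattice : set 'rV[R]_n := [set x | x \is a mxOver Num.int].

Definition conv_hull S : set 'rV[R]_n :=
  [set x | exists m (p : 'I_m -> 'rV[R]_n) (c : 'I_m -> R),
    [/\ forall i, S (p i), forall i, 0 <= c i,
        \sum_i c i = 1 & x = \sum_i c i *: p i]].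

Definition cone_hull S : set 'rV[R]_n :=
  [set x | exists m (p : 'I_m -> 'rV[R]_n) (c : 'I_m -> R),
    [/\ forall i, S (p i), forall i, 0 <= c i & x = \sum_i c i *: p i]].

Definition lin_span S : set 'rV[R]_n :=
  [set x | exists m (p : 'I_m -> 'rV[R]_n) (c : 'I_m -> R),
    (forall i, S (p i)) /\ x = \sum_i c i *: p i].

Definition int_span S : set 'rV[R]_n :=
  [set x | exists m (p : 'I_m -> 'rV[R]_n) (c : 'I_m -> int),
    (forall i, S (p i)) /\ x = \sum_i p i *~ c i].

Definition has_lin_dim S (k : nat) : Prop :=
  exists2 U : {vspace 'rV[R]_n}, lin_span S = [set` U] & \dim U = k.

(* The dimension of the linear space parallel to the affine hull of S. *)
Definition has_aff_dim S (k : nat) : Prop :=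
  exists2 x0, S x0 & has_lin_dim [set x - x0 | x in S] k.

Definition lattice_polytope S : Prop :=
  exists2 V : set 'rV[R]_n,
    finite_set V /\ V `<=` lattice & S = conv_hull V.

Definition dot u x : R := \sum_i u ord0 i * x ord0 i.

(* Faces are cut out by supporting hyperplanes; u = 0 gives s itself. *)
Definition is_face F s : Prop :=
  exists2 u, (forall x, s x -> 0 <= dot u x)
           & F = [set x | s x /\ dot u x = 0].

Definition primitive w : Prop :=
  lattice w /\
  forall (k : nat) u, lattice u -> w = k%:R *: u -> k = 1%N.

(* The set $\sigma^{(1)}$ of primitive generators of the extremal rays. *)
Definition ray_gens s : set 'rV[R]_n :=
  [set w | primitive w /\ is_face (cone_hull [set w]) s].

(* Rationality of the cones guarantees that every extremal ray has a
   primitive generator. *)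
Definition rational_simplicial_cone s : Prop :=
  exists2 X : seq 'rV[R]_n,
    free X /\ [set` X] `<=` lattice & s = cone_hull [set` X].

Definition cells (T : set (set 'rV[R]_n)) (k : nat) : set (set 'rV[R]_n) :=
  [set s | T s /\ has_lin_dim s k].

Definition simplicial_fan_of (C : set 'rV[R]_n) (T : set (set 'rV[R]_n)) :
    Prop :=
  [/\ finite_set T,
      T `<=` rational_simplicial_cone,
      (forall s F, T s -> is_face F s -> T F),
      (forall s t, T s -> T t -> is_face (s `&` t) s /\ is_face (s `&` t) t)
    & \bigcup_(s in T) s = C].

(* The full-dimensional cones of T are the domains of linearity of a convex
   function on C. *)
Definition regular (C : set 'rV[R]_n) (T : set (set 'rV[R]_n)) : Prop :=
  exists2 f : 'rV[R]_n -> R, convex_function C f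
    & forall s, cells T n s ->
        exists u, s = [set x | C x /\ f x = dot u x].

End Convexity.

Section HalfOpen.
Variables (R : realType) (d : nat).
Implicit Types (s : set 'rV[R]_(1 + d)) (T : set (set 'rV[R]_(1 + d))).
Implicit Types (C : set 'rV[R]_(1 + d)) (w x y xi : 'rV[R]_(1 + d)).

Definition first_coord x : R := x ord0 (lshift d ord0).

Definition height_one (P : set 'rV[R]_d) : set 'rV[R]_(1 + d) :=
  [set row_mx (const_mx 1) p | p in P].

Definition cone_over (P : set 'rV[R]_d) : set 'rV[R]_(1 + d) :=
  cone_hull (height_one P).

Definition Gamma (P : set 'rV[R]_d) : set 'rV[R]_(1 + d) :=
  int_span (height_one P `&` @lattice R (1 + d)).

Definition Upsilon C : set (set (set 'rV[R]_(1 + d))) :=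
  [set T | [/\ simplicial_fan_of C T, regular C T
             & forall s w, T s -> ray_gens s w -> first_coord w = 1]].

Definition generic T xi : Prop :=
  forall s, cells T d s -> ~ lin_span s xi.

Definition Xi C : set 'rV[R]_(1 + d) :=
  [set xi | C xi /\ forall T, Upsilon C T -> generic T xi].

Definition ray_comb s (l : 'rV[R]_(1 + d) -> R) : 'rV[R]_(1 + d) :=
  \sum_(w \in ray_gens s) l w *: w.

(* For s simplicial of full dimension the coefficients l are determined on
   the ray generators of s. *)
Definition neg_rays xi s : set 'rV[R]_(1 + d) :=
  [set w | ray_gens s w /\ exists2 l, xi = ray_comb s l & l w < 0].

Definition half_open_cell xi s : set 'rV[R]_(1 + d) :=
  [set x | exists2 m, x = ray_comb s m
    & (forall w, ray_gens s w -> 0 <= m w) /\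
      (forall w, neg_rays xi s w -> 0 < m w)].

Definition half_open_box xi s : set 'rV[R]_(1 + d) :=
  [set x | exists2 l, x = ray_comb s l
    & (forall w, ray_gens s w -> ~ neg_rays xi s w -> 0 <= l w < 1) /\
      (forall w, neg_rays xi s w -> 0 < l w <= 1)].

(* For T in Upsilon C, xi in Xi C and x a lattice point of C, the sets to
   which xget is applied in the next two definitions are singletons. *)
Definition cell_of T xi x : set 'rV[R]_(1 + d) :=
  xget set0 [set s | cells T (1 + d) s /\ half_open_cell xi s x].

Definition frac_part T xi x : 'rV[R]_(1 + d) :=
  xget 0 [set y |
    [/\ half_open_box xi (cell_of T xi x) y, lattice y
      & exists m : 'rV[R]_(1 + d) -> nat,
          x - y = ray_comb (cell_of T xi x) (fun w => (m w)%:R)]].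

Definition hstar T xi x : R := first_coord (frac_part T xi x).

End HalfOpen.

(* Main.v *)
Require Import Defs.
From HB Require Import structures.
From mathcomp Require Import all_boot all_order all_algebra.
From mathcomp Require Import boolp classical_sets functions cardinality.
From mathcomp Require Import fsbigop set_interval reals convex.
From mathcomp Require Import interval_inference lra zify.
Set Implicit Arguments.
Unset Strict Implicit.
Unset Printing Implicit Defensive.
Import Order.TTheory GRing.Theory Num.Theory.
Local Open Scope classical_set_scope.
Local Open Scope ring_scope.

(* Let [M] be the set of lattice points of the cone lying in the coset.
   Independence of the pair: the map [x |-> {x}] writes [x] uniquely as a box point plus a
   nonnegative integer combination of the [d + 1] height-one generators of a cell,
   so [#M_n = \sum_k h_k * c (n - k)], where [h_k] counts the box points of height
   [k] and [c j] is the number of compositions of [j] into [d + 1] parts; hence the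
   [h_k] depend on [M] only.  In particular [xi] may be moved freely.
   No gaps: suppose that [h_k = 0].  If [x = m + b_1 + ... + b_r] with [m] in [M] of
   height [< k] and vertices [b_i] of the triangulation, choose such an expression of
   least total value of the convex function [f] which defines the triangulation.
   Subsums of height [<= k] can be re-expanded in their cell, since their box point
   cannot have height [k]; so minimality puts [m] and any [k - height m] of the
   [b_i] in a common cell.  If all the [b_i] are not in a common cell with [m], a
   minimal bad subset [J] of the [b_i] together with a suitable cell containing
   [J \ b] gives a direction [xi = b] in which all of [J \ b] is negative, and
   after moving [xi] a box point of height exactly [k], a contradiction.  Thus
   [x] has a box point of height [< k].  But a box point [y] of height [> k] becomes,
   after adding a large multiple of the generators of its cell, such a sum [x]. *)

(** * Coordinates of vectors with respect to a free family *)

Section Coordinates.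
Variables (R : realType) (vT : vectType R).
Implicit Types (W : seq vT) (x y w : vT).

(** Coordinates are indexed by the generator itself rather than by its position, so that cells
    sharing generators can be compared directly. The value is 0 when [w] is not in [W]. *)
Definition coef W x w : R :=
  oapp (fun i => coord (in_tuple W) i x) 0 (insub (index w W)).

Lemma coefD W x y w : coef W (x + y) w = coef W x w + coef W y w.
Proof. by rewrite /coef; case: insub => [i|] /=; rewrite ?linearD ?addr0. Qed.

Lemma coefZ W t x w : coef W (t *: x) w = t * coef W x w.
Proof. by rewrite /coef; case: insub => [i|] /=; rewrite ?linearZ ?mulr0. Qed.

Lemma coefB W x y w : coef W (x - y) w = coef W x w - coef W y w.
Proof. by rewrite /coef; case: insub => [i|] /=; rewrite ?linearB ?subr0. Qed.

Lemma coef0 W w : coef W 0 w = 0.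
Proof. by rewrite -(scale0r (0 : vT)) coefZ mul0r. Qed.

Lemma coef_sum W (I : Type) (r : seq I) (P : pred I) (F : I -> vT) w :
  coef W (\sum_(i <- r | P i) F i) w = \sum_(i <- r | P i) coef W (F i) w.
Proof.
by apply: (big_morph (fun x => coef W x w)) => [x y|]; rewrite ?coefD ?coef0.
Qed.

Lemma coef_in W u w : free W -> u \in W -> w \in W -> coef W u w = (u == w)%:R.
Proof.
move=> fW uW wW; rewrite /coef.
have iw : (index w W < size W)%N by rewrite index_mem.
have iu : (index u W < size W)%N by rewrite index_mem.
rewrite insubT /=.
rewrite -{1}(nth_index 0 uW) (@coord_free _ _ _ _ (Ordinal iu)) //.
congr (nat_of_bool _)%:R; apply/eqP/eqP => [[]|e]; last by apply: val_inj; rewrite /= e.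
by move=> e; rewrite -(nth_index 0 uW) -(nth_index 0 wW) e.
Qed.

Lemma coef_comb W c w : free W -> w \in W ->
  coef W (\sum_(u <- W) c u *: u) w = c w.
Proof.
move=> fW wW; rewrite coef_sum (bigD1_seq w) ?free_uniq //= coefZ coef_in // eqxx mulr1.
rewrite big_seq_cond big1 ?addr0 // => u /andP[uW /negPf uw].
by rewrite coefZ coef_in // uw mulr0.
Qed.

Lemma coef_span W x : x \in <<W>>%VS -> free W -> x = \sum_(w <- W) coef W x w *: w.
Proof.
move=> xW fW; have [k -> _] := free_span fW xW.
by apply: eq_big_seq => w wW; rewrite coef_comb.
Qed.

Definition full_basis W := free W /\ size W = \dim {:vT}.

Lemma full_free W : full_basis W -> free W. Proof. by case. Qed.
Lemma full_uniq W : full_basis W -> uniq W.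
Proof. by case=> /free_uniq. Qed.

Lemma full_span W : full_basis W -> <<W>>%VS = fullv.
Proof.
move=> [fW sW]; apply/eqP; rewrite eqEdim subvf /= -sW.
by move: fW; rewrite /free => /eqP ->.
Qed.

Lemma coefE W x : full_basis W -> x = \sum_(w <- W) coef W x w *: w.
Proof.
by move=> bW; apply: coef_span; rewrite ?full_span ?memvf //; case: bW.
Qed.

Lemma coef_inj W x y : full_basis W ->
  (forall w, w \in W -> coef W x w = coef W y w) -> x = y.
Proof.
by move=> bW e; rewrite (coefE x bW) (coefE y bW); apply: eq_big_seq => w /e ->.
Qed.

Definition pos W : set vT := [set x | forall w, w \in W -> 0 <= coef W x w].

Lemma posD W x y : pos W x -> pos W y -> pos W (x + y).
Proof. by move=> px py w wW; rewrite coefD addr_ge0 ?px ?py. Qed.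

Lemma posZ W t x : 0 <= t -> pos W x -> pos W (t *: x).
Proof. by move=> t0 px w wW; rewrite coefZ mulr_ge0 ?px. Qed.

Lemma pos_gen W w : free W -> w \in W -> pos W w.
Proof. by move=> fW wW u uW; rewrite coef_in // ler0n. Qed.

Lemma pos0 W : pos W 0. Proof. by move=> w _; rewrite coef0. Qed.

Lemma pos_sum W (r : seq vT) : (forall w, w \in r -> pos W w) ->
  pos W (\sum_(w <- r) w).
Proof.
by move=> rW; rewrite big_seq; apply: (big_ind (pos W)) => //;
  [exact: pos0 | exact: posD].
Qed.

End Coordinates.

(** * Properties that hold for all sufficiently small, or for arbitrarily small, positive reals *)

Section Small.
Variable R : realType.
Implicit Types (a b : R) (P Q : R -> Prop).

Definition small P := exists2 e : R, 0 < e & forall t, 0 < t < e -> P t.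

Lemma small_and P Q : small P -> small Q -> small (fun t => P t /\ Q t).
Proof.
move=> [e e0 Pe] [e' e0' Qe]; exists (Num.min e e'); first by rewrite lt_min e0.
by move=> t; rewrite lt_min => /and3P[t0 te te']; split; [apply: Pe|apply: Qe]; apply/andP.
Qed.

Lemma small_ex P : small P -> exists2 t, 0 < t & P t.
Proof. by move=> [e e0 Pe]; exists (e / 2); [lra | apply: Pe; lra]. Qed.

Lemma small_all (I : eqType) (r : seq I) (P : I -> R -> Prop) :
  (forall i, i \in r -> small (P i)) ->
  small (fun t => forall i, i \in r -> P i t).
Proof.
elim: r => [|i r IH] sP; first by exists 1.
have [||e e0 He] := @small_and (P i) (fun t => forall i, i \in r -> P i t).
- by apply: sP; rewrite mem_head.
- by apply: IH => j jr; apply: sP; rewrite inE jr orbT.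
by exists e => // t /He [Pi Pr] j; rewrite inE => /orP[/eqP->|/Pr].
Qed.

Lemma small_affine_gt0 a b : 0 < a -> small (fun t => 0 < a + t * b).
Proof.
move=> a0; have n0 := normr_ge0 b; exists (a / (`|b| + 1)).
  by rewrite divr_gt0 //; lra.
move=> t /andP[t0]; rewrite ltr_pdivlMr; last by lra.
move=> tb; have : - (t * `|b|) <= t * b.
  by rewrite -mulrN ler_pM2l // lerNl -normrN ler_norm.
by lra.
Qed.

Lemma small_affine_neq0 a b : b != 0 -> small (fun t => a + t * b != 0).
Proof.
move=> b0; have [a0|a0|->] := ltgtP a 0; last first.
- by exists 1 => // t /andP[t0 _]; rewrite add0r mulf_neq0 // lt0r_neq0.
- by have [e e0 h] := small_affine_gt0 b a0; exists e => // t /h /lt0r_neq0.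
have [|e e0 h] := @small_affine_gt0 (- a) (- b); first by lra.
by exists e => // t /h ?; apply: ltr0_neq0; lra.
Qed.

Definition freq P := forall e : R, 0 < e -> exists2 t, 0 < t < e & P t.

Lemma freq_small P Q : freq P -> small Q -> exists t, [/\ 0 < t, P t & Q t].
Proof. by move=> fP [e e0 Qe]; have [t te Pt] := fP e e0; exists t; split => //;
  [by case/andP: te | exact: Qe]. Qed.

(** Letting [t] tend to 0 gives the sign of [a]; if [a] vanishes, dividing by [t] gives the sign of
    [b]. *)
Lemma freq_affine a b : freq (fun t => 0 <= a + t * b) ->
  0 <= a /\ (a = 0 -> 0 <= b).
Proof.
move=> fP; split.
  rewrite leNgt; apply/negP => a0.
  have [|t [_ h1 h2]] := freq_small fP (@small_affine_gt0 (- a) (- b) _); first by lra.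
  by lra.
move=> a0; have [t /andP[t0 _] h] := fP 1 ltr01.
by move: h; rewrite a0 add0r pmulr_rge0.
Qed.

(** An index whose property is not frequent fails on a whole interval [0 < t < e], so it can be
    discarded after shrinking the interval. *)
Lemma pigeonhole (I : eqType) (r : seq I) (P : I -> R -> Prop) :
  small (fun t => exists2 i, i \in r & P i t) ->
  exists2 i, i \in r & freq (P i).
Proof.
elim: r => [|i r IH] sP; first by have [t _ [i]] := small_ex sP.
have [fi|nfi] := pselect (freq (P i)); first by exists i; rewrite ?mem_head.
have [e e0 ne] : exists2 e : R, 0 < e & forall t, 0 < t < e -> ~ P i t.
  move: nfi => /existsNP[e] /not_implyP[e0] nP; exists e => // t te Pt.
  by apply: nP; exists t.
have [|j jr fj] := IH; last by exists j; rewrite // inE jr orbT.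
have [|e' e0' h] := small_and sP (Q := fun t => ~ P i t); first by exists e.
exists e' => // t /h [[j]]; rewrite inE => /orP[/eqP-> //|jr Pj _].
by exists j.
Qed.

End Small.

(** * Triangulations as lists of bases, half-open cells and half-open boxes *)

Section Triangulations.
Variables (R : realType) (d : nat).
Local Notation V := 'rV[R]_(1 + d).
Implicit Types (C A Q : set V) (W : seq V) (Ws : seq (seq V)) (x y w xi : V).

Lemma first_coordD x y : first_coord (x + y) = first_coord x + first_coord y.
Proof. by rewrite /first_coord mxE. Qed.

Lemma first_coordZ t x : first_coord (t *: x) = t * first_coord x.
Proof. by rewrite /first_coord mxE. Qed.

Lemma first_coord_sum (I : Type) (r : seq I) (P : pred I) (F : I -> V) :
  first_coord (\sum_(i <- r | P i) F i) = \sum_(i <- r | P i) first_coord (F i).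
Proof. by rewrite /first_coord summxE. Qed.

Record conic C : Prop := {
  conic0 : C 0;
  conicD : forall x y, C x -> C y -> C (x + y);
  conicZ : forall t x, 0 <= t -> C x -> C (t *: x) }.

Lemma conic_sum C (I : eqType) (r : seq I) (F : I -> V) : conic C ->
  (forall i, i \in r -> C (F i)) -> C (\sum_(i <- r) F i).
Proof.
move=> cC rC; rewrite big_seq; apply: (big_ind C) => //.
- exact: conic0.
- exact: conicD.
Qed.

(** A point [x] of [U i] is pushed off [U i] by any positive multiple of [c]. For every other [U j]
    at most one positive [t] puts [x + t *: c] into [U j]: two such would put [c], hence [x], into
    it. *)
Lemma conic_avoid C (I : eqType) (r : seq I) (U : I -> set V) : conic C ->
  (forall i t x y, U i x -> U i y -> U i (t *: x + y)) ->
  (forall i, i \in r -> exists2 c, C c & ~ U i c) ->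
  exists2 x, C x & forall i, i \in r -> ~ U i x.
Proof.
move=> cC linU; elim: r => [|i r IH] rU; first by exists 0; [exact: conic0|].
have [|x Cx xU] := IH; first by move=> j jr; apply: rU; rewrite inE jr orbT.
have [c Cc cU] := rU i (mem_head _ _).
have [Ux|nUx] := pselect (U i x); last first.
  by exists x => // j; rewrite inE => /orP[/eqP->|/xU].
have : small (fun t => forall j, j \in r -> ~ U j (x + t *: c)).
  apply: small_all => j jr.
  have nC : U j c -> forall t, ~ U j (x + t *: c).
    move=> Uc t Ut; apply: (xU j jr).
    by have := linU j (- t) _ _ Uc Ut; rewrite addrC scaleNr addrK.
  have [[t0 t0p Ut0]|nU] := pselect (exists2 t0, 0 < t0 & U j (x + t0 *: c)).
    exists t0 => // t /andP[tp tt0] Ut.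
    have Uc : U j c.
      have U1 := linU j (-1) _ _ Ut Ut0.
      have e : -1 *: (x + t *: c) + (x + t0 *: c) = (t0 - t) *: c.
        by rewrite scaleN1r opprD addrACA addNr add0r scalerBl addrC.
      have U0 : U j 0.
        by have := linU j (-1) _ _ Ut Ut; rewrite scaleN1r addNr.
      have := linU j (t0 - t)^-1 _ _ U1 U0.
      rewrite e addr0 scalerA mulVf ?scale1r //.
      by rewrite subr_eq0 gt_eqF.
    exact: (nC Uc t Ut).
  by exists 1 => // t /andP[tp _] Ut; apply: nU; exists t.
move=> /small_ex[t tp ht]; exists (x + t *: c).
  by apply: conicD => //; apply: conicZ => //; apply: ltW.
move=> j; rewrite inE => /orP[/eqP->|/ht //] Ut; apply: cU.
have U1 := linU i (-1) _ _ Ux Ut.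
have U0 : U i 0 by have := linU i (-1) _ _ Ux Ux; rewrite scaleN1r addNr.
have := linU i t^-1 _ _ U1 U0.
by rewrite scaleN1r addKr addr0 scalerA mulVf ?scale1r ?lt0r_neq0.
Qed.

Record height_one_points C A : Prop := {
  hA_cone : A `<=` C;
  hA_lattice : A `<=` @lattice R (1 + d);
  hA_one : forall a, A a -> first_coord a = 1 }.

(** Only the maximal cells are recorded, each by its list of generators. [tri_regular] says that on
    [C] the function [f] is the maximum of the linear forms given by [u W], and that the form of [W]
    attains it exactly on the cone spanned by [W]. *)
Record triangulation C A Ws : Prop := {
  tri_basis : forall W, W \in Ws -> full_basis W;
  tri_sub : forall W w, W \in Ws -> w \in W -> A w;
  tri_cover : forall x, C x -> exists2 W, W \in Ws & pos W x;
  tri_face : forall W W' x w, W \in Ws -> W' \in Ws -> pos W x -> pos W' x ->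
    w \in W -> 0 < coef W x w -> w \in W';
  tri_regular : exists f : V -> R, exists u : seq V -> V,
    forall x W, C x -> W \in Ws ->
      dot (u W) x <= f x /\ (pos W x <-> f x = dot (u W) x) }.

(** Genericity for a single triangulation, so that the no-gap argument may perturb [xi]; [Xi] asks
    for genericity with respect to all triangulations at once. *)
Definition generic_in C Ws xi :=
  C xi /\ forall W w, W \in Ws -> w \in W -> coef W xi w != 0.

Definition in_half_open W xi x := forall w, w \in W ->
  0 <= coef W x w /\ (coef W xi w < 0 -> 0 < coef W x w).

(** For [xi = 0] every coordinate ranges over [0, 1): this is the reduced box of the no-gap
    argument. *)
Definition box W xi y := forall w, w \in W ->
  if coef W xi w < 0 then 0 < coef W y w <= 1 else 0 <= coef W y w < 1.

Definition box_dec W xi y x :=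
  box W xi y /\ exists m : V -> nat, x = y + \sum_(w <- W) (m w)%:R *: w.

(** For the maximal cells of a fan these are the values of [hstar] on the points of [Q] in the cone,
    by [hstar_image]. *)
Definition box_heights Q Ws xi (k : nat) := exists W, exists y,
  [/\ W \in Ws, box W xi y, Q y & first_coord y = k%:R].

Lemma coef_eqi W W' x w : full_basis W -> full_basis W' -> W =i W' ->
  w \in W -> coef W' x w = coef W x w.
Proof.
move=> bW bW' e wW; rewrite {2}(coefE x bW').
rewrite (perm_big W) /=; last first.
  by apply: uniq_perm; rewrite ?full_uniq // => u; rewrite e.
by rewrite coef_comb // full_free.
Qed.

Lemma floor_unique (a b : R) (z : int) : 0 <= a < 1 -> 0 <= b < 1 ->
  a = b + z%:~R -> z = 0.
Proof.
move=> ha hb e.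
have h1 : (z%:~R : R) < 1%:~R by rewrite mulr1z; lra.
have h2 : (-1)%:~R < (z%:~R : R) by rewrite mulrN1z; lra.
by move: h1 h2; rewrite !ltr_int; lia.
Qed.

Lemma ceil_unique (a b : R) (z : int) : 0 < a <= 1 -> 0 < b <= 1 ->
  a = b + z%:~R -> z = 0.
Proof.
move=> ha hb e.
have h1 : (z%:~R : R) < 1%:~R by rewrite mulr1z; lra.
have h2 : (-1)%:~R < (z%:~R : R) by rewrite mulrN1z; lra.
by move: h1 h2; rewrite !ltr_int; lia.
Qed.

Lemma dec_uniq W xi x y y' : full_basis W ->
  box_dec W xi y x -> box_dec W xi y' x -> y = y'.
Proof.
move=> bW [by_ [m e]] [by' [m' e']]; apply: (coef_inj bW) => w wW.
have := congr1 (fun z => coef W z w) e; rewrite e' !coefD !coef_comb ?full_free // => ew.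
have ew' : coef W y w = coef W y' w + ((m' w)%:Z - (m w)%:Z)%:~R.
  by rewrite intrB; lra.
move: (by_ w wW) (by' w wW); case: ifP => _ h h'.
- by rewrite ew' (ceil_unique h h' ew') addr0.
- by rewrite ew' (floor_unique h h' ew') addr0.
Qed.

Lemma dec_hopen W xi y x : full_basis W -> box_dec W xi y x -> in_half_open W xi x.
Proof.
move=> bW [by_ [m ->]] w wW; rewrite coefD coef_comb ?full_free //.
have m0 : 0 <= (m w)%:R :> R by rewrite ler0n.
move: (by_ w wW); case: ifP => _ h.
  by split; [|move=> _]; lra.
by split => //; lra.
Qed.

Lemma dec_ex W xi x : full_basis W -> in_half_open W xi x -> exists y, box_dec W xi y x.
Proof.
move=> bW hx.
(* The integer part to remove: the floor leaves a remainder in [0, 1), the ceiling minus one leaves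
   a remainder in (0, 1]. *)
pose z w : int := if coef W xi w < 0 then Num.ceil (coef W x w) - 1
                  else Num.floor (coef W x w).
have zE w : w \in W -> ((`|z w|%N)%:R : R) = (z w)%:~R.
  move=> wW; rewrite pmulrn gez0_abs //.
  have [h1 h2] := hx w wW; rewrite /z; case: ifP => [/h2 h|_].
    have : 0 < Num.ceil (coef W x w) by rewrite Num.Theory.ceil_gt0.
    by lia.
  by rewrite Num.Theory.floor_ge0.
exists (x - \sum_(w <- W) (`|z w|%N)%:R *: w); split; last first.
  by exists (fun w => `|z w|%N); rewrite subrK.
move=> w wW; rewrite coefB coef_comb ?full_free // zE // /z.
case: (coef W xi w < 0).
  have := ceil_itv (coef W x w); rewrite intrB mulr1z; lra.
by have := floor_itv (coef W x w); rewrite intrD mulr1z; lra.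
Qed.

Lemma dec_refl W xi y : box W xi y -> box_dec W xi y y.
Proof.
move=> h; split => //; exists (fun=> 0%N).
by rewrite big1 ?addr0 // => w _; rewrite scale0r.
Qed.

Lemma dec_eqi W W' xi y x : full_basis W -> full_basis W' -> W =i W' ->
  box_dec W' xi y x -> box_dec W xi y x.
Proof.
move=> bW bW' e [by' [m ->]]; split.
  move=> w wW; have := by' w; rewrite -e => /(_ wW).
  by rewrite !(@coef_eqi W W').
exists m; congr (_ + _); apply: perm_big.
by apply: uniq_perm; rewrite ?full_uniq // => u; rewrite e.
Qed.

Section Fixed.
Variables (C A : set V) (Ws : seq (seq V)).
Hypothesis cC : conic C.
Hypothesis hA : height_one_points C A.
Hypothesis tW : triangulation C A Ws.

Lemma tri_gen_cone W w : W \in Ws -> w \in W -> C w.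
Proof. by move=> WW wW; apply: (hA_cone hA); apply: (tri_sub tW WW). Qed.

Lemma pos_cone W x : W \in Ws -> pos W x -> C x.
Proof.
move=> WW px; rewrite (coefE x (tri_basis tW WW)); apply: conic_sum => // w wW.
by apply: conicZ => //; [exact: px | exact: tri_gen_cone WW wW].
Qed.

(** A point of two cells is supported on common generators by [tri_face], so its expansion in [W] is
    also an expansion in the basis [W']. *)
Lemma tri_coef_eq W W' x w : W \in Ws -> W' \in Ws -> pos W x -> pos W' x ->
  w \in W -> 0 < coef W x w -> coef W' x w = coef W x w.
Proof.
move=> WW WW' px px' wW cw.
have bW := tri_basis tW WW; have bW' := tri_basis tW WW'.
have wW' := tri_face tW WW WW' px px' wW cw.
pose c u := if u \in W then coef W x u else 0.
suff e : x = \sum_(u <- W') c u *: u.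
  by rewrite {1}e coef_comb ?full_free // /c wW.
rewrite {1}(coefE x bW) (bigID (fun u => 0 < coef W x u)) /=.
rewrite [X in _ + X]big1_seq ?addr0; last first.
  move=> u /andP[ncu uW]; have := px u uW; rewrite le_eqVlt (negPf ncu) orbF.
  by move=> /eqP <-; rewrite scale0r.
rewrite [RHS](bigID (fun u => (u \in W) && (0 < coef W x u))) /=.
rewrite [X in _ = _ + X]big1_seq ?addr0; last first.
  move=> u /andP[ncu uW']; rewrite /c; case: ifP ncu => uW /= ncu; last by rewrite scale0r.
  have := px u uW; rewrite le_eqVlt (negPf ncu) orbF.
  by move=> /eqP <-; rewrite scale0r.
rewrite -big_filter -[RHS]big_filter.
rewrite (perm_big [seq u <- W' | (u \in W) && (0 < coef W x u)]) /=; last first.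
  apply: uniq_perm; rewrite ?filter_uniq ?full_uniq // => u; rewrite !mem_filter.
  apply/idP/idP => [/andP[cu uW]|/andP[/andP[uW cu] _]]; last by rewrite cu.
  by rewrite uW cu (tri_face tW WW WW' px px').
by apply: eq_big_seq => u; rewrite mem_filter /c => /andP[/andP[-> _] _].
Qed.

Lemma tri_vertex W W' w : W \in Ws -> W' \in Ws -> w \in W -> pos W' w -> w \in W'.
Proof.
move=> WW WW' wW pw; have fW := full_free (tri_basis tW WW).
apply: (tri_face tW WW WW' _ pw wW); first exact: pos_gen.
by rewrite coef_in // eqxx ltr01.
Qed.

(** Each hyperplane to be avoided, the zero set of the coordinate of [w] in [W], misses the point
    [w] of [C]. *)
Lemma gen_ex : exists xi, generic_in C Ws xi.
Proof.
have [||xi Cxi hxi] := @conic_avoid C _ (allpairs_dep pair Ws id)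
  (fun p x => coef p.1 x p.2 = 0) cC.
- by move=> [W w] t x y /= ex ey; rewrite coefD coefZ ex ey mulr0 addr0.
- move=> [W w] /allpairsPdep[W' [w' [WW wW [-> ->]]]] /=.
  exists w'; first exact: tri_gen_cone WW wW.
  by rewrite coef_in ?(full_free (tri_basis tW WW)) // eqxx; apply/eqP/oner_neq0.
exists xi; split=> // W w WW wW; apply/eqP; apply: (hxi (W, w)).
by apply/allpairsPdep; exists W, w.
Qed.

(** A small multiple of a generic point is added: it makes all coordinates in all cells nonzero and
    keeps the signs of the nonzero coordinates in [W]. *)
Lemma gen_perturb xi0 W : C xi0 -> W \in Ws ->
  (forall w, w \in W -> coef W xi0 w != 0) ->
  exists2 xi, generic_in C Ws xi &
    forall w, w \in W -> (coef W xi w < 0) = (coef W xi0 w < 0).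
Proof.
move=> Cxi WW nz; have [eta [Ceta neta]] := gen_ex.
have s1 : small (fun t => forall p, p \in allpairs_dep pair Ws id ->
    coef p.1 xi0 p.2 + t * coef p.1 eta p.2 != 0).
  apply: small_all => _ /allpairsPdep[W' [w' [WW' wW' ->]]] /=.
  by apply: small_affine_neq0; apply: neta.
have s2 : small (fun t => forall w, w \in W ->
    (coef W xi0 w + t * coef W eta w < 0) = (coef W xi0 w < 0)).
  apply: small_all => w wW; have [h|h|h] := ltgtP (coef W xi0 w) 0.
  - have [|e e0 he] := @small_affine_gt0 _ (- coef W xi0 w) (- coef W eta w); first by lra.
    by exists e => // t /he ?; apply/idP; lra.
  - have [e e0 he] := @small_affine_gt0 _ _ (coef W eta w) h.
    by exists e => // t /he ?; apply/negbTE; rewrite -leNgt ltW.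
  - by move: (nz w wW); rewrite h eqxx.
have [t t0 [h1 h2]] := small_ex (small_and s1 s2).
exists (xi0 + t *: eta); last by move=> w wW; rewrite coefD coefZ h2.
split; first by apply: conicD => //; apply: conicZ => //; apply: ltW.
move=> W' w' WW' wW'; rewrite coefD coefZ; apply: (h1 (W', w')).
by apply/allpairsPdep; exists W', w'.
Qed.

(** [W] is a cell that contains [x + t *: eta] for arbitrarily small [t], which exists because there
    are finitely many cells. *)
Lemma tri_direction x eta : C x -> C eta -> exists2 W, W \in Ws &
  pos W x /\ forall w, w \in W -> coef W x w = 0 -> 0 <= coef W eta w.
Proof.
move=> Cx Ce.
have [|W WW fW] := @pigeonhole R _ Ws (fun W t => pos W (x + t *: eta)).
  exists 1 => // t /andP[/ltW t0 _]; apply: (tri_cover tW).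
  by apply: conicD => //; apply: conicZ.
have h w : w \in W -> freq (fun t => 0 <= coef W x w + t * coef W eta w).
  move=> wW e e0; have [t te pt] := fW e e0; exists t => //.
  by have := pt w wW; rewrite coefD coefZ.
exists W => //; split=> [w /h/freq_affine[]//|w /h/freq_affine[_ h0] e].
exact: h0.
Qed.

(** The half-open cell containing [x] is the cell entered on leaving [x] in the direction [xi]. *)
Lemma hopen_ex xi x : generic_in C Ws xi -> C x -> exists2 W, W \in Ws & in_half_open W xi x.
Proof.
move=> [Cxi gxi] Cx; have [W WW [px h]] := tri_direction Cx Cxi.
exists W => // w wW; split; first exact: px.
move=> xin; rewrite lt_neqAle px // andbT; apply/negP => /eqP /esym /(h _ wW).
by rewrite leNgt xin.
Qed.

Lemma hopen_pos W xi x : in_half_open W xi x -> pos W x.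
Proof. by move=> h w /h []. Qed.

Lemma hopen_small W xi x : generic_in C Ws xi -> W \in Ws -> in_half_open W xi x ->
  small (fun t => forall w, w \in W -> 0 < coef W (x + t *: xi) w).
Proof.
move=> [Cxi gxi] WW hx; apply: small_all => w wW.
have [h1 h2] := hx w wW; have xw := gxi W w WW wW.
have [x0|x0] := eqVneq (coef W x w) 0.
  exists 1 => // t /andP[t0 _]; rewrite coefD coefZ x0 add0r mulr_gt0 //.
  have [/h2|//|e] := ltgtP (coef W xi w) 0; first by rewrite x0 ltxx.
  by rewrite e eqxx in xw.
have [|e e0 he] := @small_affine_gt0 _ (coef W x w) (coef W xi w).
  by rewrite lt_neqAle eq_sym x0.
by exists e => // t /he; rewrite coefD coefZ.
Qed.

(** For small [t] the point [x + t *: xi] is interior to both cells, and a generator with positive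
    coordinate at a common point is shared. *)
Lemma hopen_uniq W W' xi x : generic_in C Ws xi -> W \in Ws -> W' \in Ws ->
  in_half_open W xi x -> in_half_open W' xi x -> W =i W'.
Proof.
move=> gxi WW WW' h h'.
have [t t0 [p p']] :=
  small_ex (small_and (hopen_small gxi WW h) (hopen_small gxi WW' h')).
have q : pos W (x + t *: xi) by move=> w /p/ltW.
have q' : pos W' (x + t *: xi) by move=> w /p'/ltW.
move=> w; apply/idP/idP => wW.
- exact: (tri_face tW WW WW' q q' wW (p _ wW)).
- exact: (tri_face tW WW' WW q' q wW (p' _ wW)).
Qed.

Lemma dec_tri_uniq W W' xi x y y' : generic_in C Ws xi -> W \in Ws -> W' \in Ws ->
  box_dec W xi y x -> box_dec W' xi y' x -> W =i W' /\ y = y'.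
Proof.
move=> gxi WW WW' h h'; have bW := tri_basis tW WW; have bW' := tri_basis tW WW'.
have e := hopen_uniq gxi WW WW' (dec_hopen bW h) (dec_hopen bW' h').
by split=> //; apply: (dec_uniq bW h); apply: dec_eqi h'.
Qed.

End Fixed.
End Triangulations.

(** * Counting lattice points by height; independence of the triangulation and of the generic
    point *)

Lemma convolution_inj (a b c : nat -> nat) : c 0%N = 1%N ->
  (forall n, \sum_(k < n.+1) a k * c (n - k) = \sum_(k < n.+1) b k * c (n - k))%N ->
  forall n, a n = b n.
Proof.
move=> c0 e n; elim/ltn_ind: n => n IH.
have := e n; rewrite !big_ord_recr /= subnn c0 !muln1.
rewrite (eq_bigr (fun k : 'I_n => b k * c (n - k))%N); first by move/addnI.
by move=> k _; rewrite IH.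
Qed.

Lemma sum_index (T : eqType) (W : seq T) (F : nat -> nat) : uniq W ->
  (\sum_(w <- W) F (index w W) = \sum_(i < size W) F i)%N.
Proof.
case: W => [|x W0]; first by rewrite big_nil big_ord0.
move=> uW; rewrite (big_nth x) big_mkord; apply: eq_bigr => i _.
by rewrite index_uniq.
Qed.

Section Counting.
Variables (R : realType) (d : nat).
Local Notation V := 'rV[R]_(1 + d).
Implicit Types (C A Q : set V) (W : seq V) (Ws : seq (seq V)) (x y w xi : V).

Record coset A Q : Prop := {
  coset_lattice : Q `<=` @lattice R (1 + d);
  cosetD : forall x a, Q x -> A a -> Q (x + a);
  cosetB : forall x a, Q x -> A a -> Q (x - a);
  coset_diff : forall x y, Q x -> Q y -> int_span A (x - y) }.

Lemma cosetDn A Q x a n : coset A Q -> A a -> Q x -> Q (x + n%:R *: a).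
Proof.
move=> cQ Aa Qx; elim: n => [|n IH]; first by rewrite scale0r addr0.
by rewrite -natr1 scalerDl scale1r addrA; apply: (cosetD cQ).
Qed.

Lemma cosetBn A Q x a n : coset A Q -> A a -> Q x -> Q (x - n%:R *: a).
Proof.
move=> cQ Aa Qx; elim: n => [|n IH]; first by rewrite scale0r subr0.
by rewrite -natr1 scalerDl scale1r opprD addrA; apply: (cosetB cQ).
Qed.

Lemma cosetD_comb A Q x W (m : V -> nat) : coset A Q ->
  (forall w, w \in W -> A w) -> Q x -> Q (x + \sum_(w <- W) (m w)%:R *: w).
Proof.
move=> cQ; elim: W x => [|w W IH] x WA Qx; first by rewrite big_nil addr0.
rewrite big_cons addrA; apply: IH => [u uW|]; first by apply: WA; rewrite inE uW orbT.
by apply: (cosetDn _ cQ) => //; apply: WA; rewrite mem_head.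
Qed.

Lemma cosetB_comb A Q x W (m : V -> nat) : coset A Q ->
  (forall w, w \in W -> A w) -> Q x -> Q (x - \sum_(w <- W) (m w)%:R *: w).
Proof.
move=> cQ; elim: W x => [|w W IH] x WA Qx; first by rewrite big_nil subr0.
rewrite big_cons opprD addrA; apply: IH => [u uW|]; first by apply: WA; rewrite inE uW orbT.
by apply: (cosetBn _ cQ) => //; apply: WA; rewrite mem_head.
Qed.

Lemma bounded_lattice_points (K : nat) : exists L : seq V, forall x : V,
  lattice x -> (forall i, `|x ord0 i| <= K%:R) -> x \in L.
Proof.
exists [seq \row_i ((m i : nat)%:R - K%:R) |
  m : {ffun 'I_(1 + d) -> 'I_(K + K).+1} <- enum {ffun 'I_(1 + d) -> 'I_(K + K).+1}].
move=> x /mxOverP lx bx.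
apply/mapP; have z i : {z : int | x ord0 i = z%:~R} by apply: cid; apply/intrP.
have zb i : 0 <= sval (z i) + K%:Z /\ (absz (sval (z i) + K%:Z)%R < (K + K).+1)%N.
  have := bx i; case: (z i) => /= k ->.
  rewrite -[K%:R]/(K%:~R) -intr_norm ler_int => kK.
  by split; lia.
exists [ffun i => inord (absz (sval (z i) + K%:Z)%R)]; first by rewrite mem_enum.
apply/rowP => i; rewrite !mxE ffunE inordK; last by case: (zb i).
rewrite pmulrn gez0_abs; last by case: (zb i).
by rewrite intrD addrK; case: (z i).
Qed.

(** Zero parts are allowed. A part of a composition of [j] is at most [j], so functions into
    ['I_j.+1] capture all of them. *)
Definition compositions (j : nat) :=
  #|[pred m : {ffun 'I_(1 + d) -> 'I_j.+1} | (\sum_i m i)%N == j]|.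

Lemma compositions0 : compositions 0 = 1%N.
Proof.
transitivity #|{: {ffun 'I_(1 + d) -> 'I_1}}|; last by rewrite card_ffun card_ord exp1n.
by apply: eq_card => m; rewrite !inE big1 // => i _; rewrite ord1.
Qed.

Lemma full_size W : full_basis W -> size W = (1 + d)%N.
Proof. by move=> [_ ->]; rewrite dimvf /dim /= mul1n. Qed.

Section Fixed.
Variables (C A Q : set V).
Hypothesis cC : conic C.
Hypothesis hA : height_one_points C A.
Hypothesis cQ : coset A Q.

Section OneTriangulation.
Variable Ws : seq (seq V).
Hypothesis tW : triangulation C A Ws.

Lemma first_coord_coef W x : W \in Ws -> first_coord x = \sum_(w <- W) coef W x w.
Proof.
move=> WW; rewrite {1}(coefE x (tri_basis tW WW)) first_coord_sum.
apply: eq_big_seq => w wW; rewrite first_coordZ (hA_one hA) ?mulr1 //.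
exact: tri_sub tW _ _ WW wW.
Qed.

Lemma first_coord_comb W (m : V -> nat) : W \in Ws ->
  first_coord (\sum_(w <- W) (m w)%:R *: w) = (\sum_(w <- W) m w)%:R.
Proof.
move=> WW; rewrite first_coord_sum natr_sum; apply: eq_big_seq => w wW.
by rewrite first_coordZ (hA_one hA) ?mulr1 //; exact: tri_sub tW _ _ WW wW.
Qed.

Lemma height_nat x : Q x -> C x -> exists k : nat, first_coord x = k%:R.
Proof.
move=> Qx Cx; have [W WW px] := tri_cover tW Cx.
have : 0 <= first_coord x.
  by rewrite (first_coord_coef _ WW) big_seq sumr_ge0.
have /mxOverP/(_ ord0 (lshift d ord0)) := coset_lattice cQ Qx.
rewrite /first_coord => xi x0; apply/natrP.
by rewrite Num.Theory.natrEint xi x0.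
Qed.

(** A point of height [j] is a nonnegative combination of the generators of a cell with coefficients
    summing to [j], which bounds its coordinates by [j * B]. *)
Lemma height_finite (j : nat) : exists L : seq V, uniq L /\
  forall x, x \in L <-> [/\ Q x, C x & first_coord x = j%:R].
Proof.
pose B := \sum_(w <- flatten Ws) \sum_i `|w ord0 i|.
have wB W w i : W \in Ws -> w \in W -> `|w ord0 i| <= B.
  move=> WW wW; rewrite /B (big_rem w) /=; last by apply/flattenP; exists W.
  rewrite (bigD1 i) //= -addrA lerDl addr_ge0 ?sumr_ge0 // => u _.
  exact: sumr_ge0.
have [L hL] := bounded_lattice_points (Num.bound (j%:R * B)).
exists (undup [seq x <- L | `[< [/\ Q x, C x & first_coord x = j%:R] >]]).
split; first exact: undup_uniq.
move=> x; rewrite mem_undup mem_filter; split; first by case/andP => /asboolP.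
move=> h; apply/andP; split; first exact/asboolP.
have [Qx Cx xj] := h; apply: hL; first exact: coset_lattice cQ _ Qx.
move=> i; have [W WW px] := tri_cover tW Cx.
have B0 : 0 <= B by apply: sumr_ge0 => w _; exact: sumr_ge0.
apply: le_trans (ltW (archi_boundP _)); last by rewrite mulr_ge0.
rewrite -xj (first_coord_coef _ WW) {1}(coefE x (tri_basis tW WW)) summxE mulr_suml.
apply: le_trans (ler_norm_sum _ _ _) _; rewrite big_seq [leRHS]big_seq.
apply: ler_sum => w wW; rewrite mxE normrM ger0_norm ?px // ler_wpM2l ?px //.
exact: wB wW.
Qed.

Section Generic.
Variable xi : V.
Hypothesis gxi : generic_in C Ws xi.

Definition in_box y := exists2 W, W \in Ws & box W xi y.
Definition decomposes y x := exists2 W, W \in Ws & box_dec W xi y x.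

Lemma decomposes_ex x : Q x -> C x -> exists y,
  [/\ decomposes y x, Q y & C y].
Proof.
move=> Qx Cx; have [W WW hx] := hopen_ex cC tW gxi Cx.
have bW := tri_basis tW WW; have [y dy] := dec_ex bW hx.
exists y; split; first by exists W.
  have [_ [m xE]] := dy.
  have -> : y = x - \sum_(w <- W) (m w)%:R *: w by rewrite xE addrK.
  by apply: (cosetB_comb _ cQ) Qx => w; apply: tri_sub tW _ _ WW.
apply: (pos_cone cC hA tW WW); apply: (@hopen_pos _ _ _ xi).
by apply: dec_hopen => //; apply: dec_refl; case: dy.
Qed.

Lemma decomposes_uniq x y y' : decomposes y x -> decomposes y' x -> y = y'.
Proof. by move=> [W WW h] [W' WW' h']; case: (dec_tri_uniq tW gxi WW WW' h h'). Qed.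

Lemma decomposes_height y x : decomposes y x -> exists j : nat,
  first_coord x = first_coord y + j%:R.
Proof.
move=> [W WW [_ [m ->]]]; exists (\sum_(w <- W) m w)%N.
by rewrite first_coordD first_coord_comb.
Qed.

Variable F : nat -> seq V.
Hypothesis F_uniq : forall j, uniq (F j).
Hypothesis FP : forall j x, x \in F j <-> [/\ Q x, C x & first_coord x = j%:R].

(** First half of a double count of the pairs of a point [x] and its box point [y]: each [x] has
    exactly one [y], of height at most [n]. *)
Lemma decomposes_once n x : x \in F n ->
  (\sum_(k < n.+1) \sum_(y <- F k | `[< in_box y >]) `[< decomposes y x >] = 1)%N.
Proof.
move=> /FP[Qx Cx xn]; have [y0 [dy Qy Cy]] := decomposes_ex Qx Cx.
have [k0 yk] := height_nat Qy Cy.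
have [j xj] := decomposes_height dy.
have k0n : (k0 < n.+1)%N.
  rewrite ltnS -(ler_nat R) -xn -yk xj lerDl; exact: ler0n.
transitivity (\sum_(k < n.+1) (k == Ordinal k0n))%N; last first.
  by rewrite -big_mkcond /= big_pred1_eq.
apply: eq_bigr => k _.
transitivity (count_mem y0 (F k)); last first.
  rewrite count_uniq_mem //; congr nat_of_bool; apply/idP/eqP.
    move=> /FP[_ _]; rewrite yk => /eqP; rewrite eqr_nat => /eqP e.
    exact: val_inj.
  by move=> ->; apply/FP.
rewrite -sum1_count [RHS]big_mkcond [LHS]big_mkcond /= [LHS]big_seq [RHS]big_seq.
apply: eq_bigr => y yF; case: asboolP => [by_|nb]; last first.
  case: eqP => // ey; case: nb; rewrite ey.
  by case: dy => W WW [? _]; exists W.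
case: asboolP => [dyx|nd].
  by rewrite (decomposes_uniq dyx dy) eqxx.
by case: eqP => // ey; case: nd; rewrite ey.
Qed.

(** Second half of the double count: [x] corresponds to the multiplicities of the generators of the
    cell of [y], which sum to [n - k] because generators have height one. *)
Lemma decomposes_count n k y : (k <= n)%N -> y \in F k -> in_box y ->
  count (fun x => `[< decomposes y x >]) (F n) = compositions (n - k).
Proof.
move=> kn yF [W WW byW]; have bW := tri_basis tW WW.
have [Qy Cy yk] := (FP _ _).1 yF.
have sW : size W = d.+1 by rewrite full_size.
set j := (n - k)%N.
pose g (mu : {ffun 'I_(1 + d) -> 'I_j.+1}) (w : V) : nat := mu (inord (index w W)).
pose psi mu := y + \sum_(w <- W) (g mu w)%:R *: w.
have psi_inj : injective psi.
  move=> mu mu' /addrI e; apply/ffunP => i; apply: val_inj => /=.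
  have iW : nth 0 W i \in W by rewrite mem_nth // sW.
  have := congr1 (fun z => coef W z (nth 0 W i)) e.
  rewrite /= !coef_comb ?full_free // => /eqP; rewrite eqr_nat => /eqP.
  by rewrite /g index_uniq ?full_uniq ?sW // inord_val.
have sum_g mu : (\sum_(w <- W) g mu w = \sum_i mu i)%N.
  rewrite (sum_index (fun i => (mu (inord i) : nat)) (full_uniq bW)) sW.
  by apply: eq_bigr => i _; rewrite inord_val.
rewrite -size_filter /compositions cardE.
rewrite -(size_map psi); apply: perm_size; apply: uniq_perm.
- by rewrite filter_uniq.
- by rewrite map_inj_uniq // enum_uniq.
move=> x; rewrite mem_filter; apply/idP/mapP.
  move=> /andP[/asboolP[W' WW' dW']] /FP[Qx Cx xn].
  have bW' := tri_basis tW WW'.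
  (* The cell [W'] decomposing [x] has the generators of [W], because [y] is its own decomposition
     in both. *)
  have [e _] := dec_tri_uniq tW gxi WW WW' (dec_refl byW) (dec_refl dW'.1).
  have [_ [m xE]] := dec_eqi bW bW' e dW'.
  have mj : (\sum_(w <- W) m w = j)%N.
    apply/eqP; rewrite -(eqr_nat R) -(first_coord_comb _ WW) natrB // -xn -yk xE.
    by rewrite first_coordD addrC addKr.
  have mle w : w \in W -> (m w < j.+1)%N.
    by move=> wW; rewrite ltnS -mj (big_rem w) //= leq_addr.
  pose mu : {ffun 'I_(1 + d) -> 'I_j.+1} := [ffun i : 'I_(1 + d) => inord (m (nth 0 W i))].
  have gm w : w \in W -> g mu w = m w.
    move=> wW; rewrite /g ffunE inordK; last first.
      by rewrite inordK ?nth_index ?mle // -sW index_mem.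
    by rewrite inordK ?nth_index // -sW index_mem.
  exists mu.
    by rewrite mem_enum inE -sum_g -mj; apply/eqP; apply: eq_big_seq.
  by rewrite xE /psi; congr (_ + _); apply: eq_big_seq => w wW; rewrite gm.
move=> [mu]; rewrite mem_enum inE => /eqP mj ->.
apply/andP; split; first by apply/asboolP; exists W => //; split => //; exists (g mu).
have AW w : w \in W -> A w by apply: tri_sub tW _ _ WW.
apply/FP; split.
- exact: (cosetD_comb _ cQ).
- apply: conicD => //; apply: conic_sum => // w wW; apply: conicZ => //.
  exact: (hA_cone hA (AW _ wW)).
- by rewrite first_coordD yk first_coord_comb // sum_g mj -natrD subnKC.
Qed.

Lemma height_count n : size (F n) =
  (\sum_(k < n.+1) count (fun y => `[< in_box y >]) (F k) * compositions (n - k))%N.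
Proof.
rewrite -sum1_size big_seq -(eq_bigr _ (fun x xF => decomposes_once xF)) -big_seq.
rewrite exchange_big /=; apply: eq_bigr => k _.
rewrite exchange_big /= -sum1_count big_distrl /=.
rewrite big_seq_cond [RHS]big_seq_cond; apply: eq_bigr => y /andP[yF /asboolP by_].
rewrite mul1n -(decomposes_count _ yF by_); last by rewrite -ltnS.
by rewrite -sum1_count [RHS]big_mkcond /=; apply: eq_bigr => x _; case: asboolP.
Qed.

Lemma htsE k : box_heights Q Ws xi k <-> (0 < count (fun y => `[< in_box y >]) (F k))%N.
Proof.
rewrite -has_count; split.
  move=> [W [y [WW by_ Qy yk]]]; apply/hasP; exists y.
    apply/FP; split=> //; apply: (pos_cone cC hA tW WW).
    apply: (@hopen_pos _ _ _ xi); apply: dec_hopen (dec_refl by_).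
    exact: tri_basis tW _ WW.
  by apply/asboolP; exists W.
move=> /hasP[y /FP[Qy Cy yk] /asboolP[W WW by_]].
by exists W, y.
Qed.

End Generic.
End OneTriangulation.

Lemma hts_independent Ws Ws' xi xi' : triangulation C A Ws -> triangulation C A Ws' ->
  generic_in C Ws xi -> generic_in C Ws' xi' -> forall k, box_heights Q Ws xi k <-> box_heights Q Ws' xi' k.
Proof.
move=> tW tW' gxi gxi' k.
(* The description of the lists [F j] mentions no triangulation, so the convolution identities of
   both triangulations have the same left-hand sides. *)
have [F hF] := choice (height_finite tW).
have Fu j : uniq (F j) by case: (hF j).
have FP j x : x \in F j <-> [/\ Q x, C x & first_coord x = j%:R].
  by case: (hF j).
rewrite (htsE tW xi FP) (htsE tW' xi' FP).
suff -> : count (fun y => `[< in_box Ws xi y >]) (F k) =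
          count (fun y => `[< in_box Ws' xi' y >]) (F k) by [].
apply: (convolution_inj (a := fun k => count (fun y => `[< in_box Ws xi y >]) (F k))
  (b := fun k => count (fun y => `[< in_box Ws' xi' y >]) (F k)) compositions0).
by move=> n; rewrite -(height_count tW gxi) // -(height_count tW' gxi').
Qed.

End Fixed.
End Counting.

(** * Expressions of minimal cost under the assumption of a gap *)

Lemma seq_argmin (R : realType) (T : eqType) (L : seq T) (P : T -> Prop) (c : T -> R) :
  (exists2 B, B \in L & P B) ->
  exists2 B, P B & forall B', B' \in L -> P B' -> c B <= c B'.
Proof.
elim: L => [|a L IH]; first by case.
have [[B BL PB] _|nL] := pselect (exists2 B, B \in L & P B).
  have [|B0 PB0 hB0] := IH; first by exists B.
  have [[Pa ca]|nP] := pselect (P a /\ c a < c B0).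
    exists a => // B'; rewrite inE => /orP[/eqP->//|BL' PB'].
    by apply: le_trans (ltW ca) _; apply: hB0.
  exists B0 => // B'; rewrite inE => /orP[/eqP->|/hB0//] Pa.
  by rewrite leNgt; apply/negP => ca; apply: nP.
move=> [B]; rewrite inE => /orP[/eqP->|BL] PB; last by case: nL; exists B.
exists a => // B'; rewrite inE => /orP[/eqP->//|BL' PB'].
by case: nL; exists B'.
Qed.

Lemma bounded_seqs (T : eqType) (r : seq T) (n : nat) : exists L : seq (seq T),
  forall B, {subset B <= r} -> (size B <= n)%N -> B \in L.
Proof.
elim: n => [|n [L hL]].
  by exists [:: [::]] => B _; rewrite leqn0 size_eq0 inE.
exists ([::] :: [seq b :: B | b <- r, B <- L]) => -[|b B] Br; first by rewrite mem_head.
rewrite ltnS => sB; rewrite inE; apply/orP; right; apply/allpairsP.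
exists (b, B); split=> //=; first by apply: Br; rewrite mem_head.
by apply: hL => // x xB; apply: Br; rewrite inE xB orbT.
Qed.

Lemma perm_subset_cat (T : eqType) (J B : seq T) : uniq J -> {subset J <= B} ->
  exists J', perm_eq B (J ++ J').
Proof.
elim: J => [|a J IH] /=; first by exists B.
move=> /andP[aJ uJ] JB; have [||J' pB] := IH => //.
  by move=> x xJ; apply: JB; rewrite inE xJ orbT.
have aJ' : a \in J'.
  have : a \in B by apply: JB; rewrite mem_head.
  by rewrite (perm_mem pB) mem_cat (negPf aJ).
exists (rem a J'); apply: perm_trans pB _.
by rewrite -cat1s perm_sym perm_catCA perm_cat2l perm_sym perm_to_rem.
Qed.

Lemma small_affine_ge0 (R : realType) (a b : R) : 0 <= a -> (a = 0 -> 0 <= b) ->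
  small (fun t => 0 <= a + t * b).
Proof.
rewrite le_eqVlt => /orP[/eqP <- /(_ erefl) b0|a0 _].
  by exists 1 => // t /andP[/ltW t0 _]; rewrite add0r mulr_ge0.
by have [e e0 he] := small_affine_gt0 b a0; exists e => // t /he/ltW.
Qed.

Section NoGap.
Variables (R : realType) (d : nat).
Local Notation V := 'rV[R]_(1 + d).
Implicit Types (W : seq V) (x y w xi : V).

Lemma coef_sum_seq W (r : seq V) w : free W -> {subset r <= W} -> w \in W ->
  coef W (\sum_(u <- r) u) w = (count_mem w r)%:R.
Proof.
move=> fW rW wW; rewrite coef_sum -sum1_count natr_sum [RHS]big_mkcond /=.
by apply: eq_big_seq => u /rW uW; rewrite coef_in //; case: (u == w).
Qed.

Lemma sum_seq_count W (r : seq V) : full_basis W -> {subset r <= W} ->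
  \sum_(u <- r) u = \sum_(w <- W) (count_mem w r)%:R *: w.
Proof.
move=> bW rW; apply: (coef_inj bW) => w wW.
by rewrite coef_sum_seq ?full_free // coef_comb ?full_free.
Qed.

Lemma nat_comb_seq W (m : V -> nat) : exists2 K, {subset K <= W} &
  \sum_(w <- W) (m w)%:R *: w = \sum_(w <- K) w.
Proof.
exists (flatten [seq nseq (m w) w | w <- W]).
  move=> x /flattenP[s /mapP[w wW ->]]; rewrite mem_nseq => /andP[_ /eqP->].
  exact: wW.
rewrite big_flatten big_map; apply: eq_bigr => w _.
by rewrite big_nseq scaler_nat iter_addr_0.
Qed.

Lemma dotD (u x y : V) : dot u (x + y) = dot u x + dot u y.
Proof. by rewrite /dot -big_split; apply: eq_bigr => i _; rewrite mxE mulrDr. Qed.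

Lemma dotZ (u : V) t x : dot u (t *: x) = t * dot u x.
Proof. by rewrite /dot mulr_sumr; apply: eq_bigr => i _; rewrite mxE mulrCA. Qed.

Lemma dot_sum (u : V) (I : Type) (r : seq I) (F : I -> V) :
  dot u (\sum_(i <- r) F i) = \sum_(i <- r) dot u (F i).
Proof.
apply: (big_morph (dot u)) => [x y|]; first exact: dotD.
by rewrite -(scale0r (0 : V)) dotZ mul0r.
Qed.

Lemma box0 W y : box W 0 y <-> forall w, w \in W -> 0 <= coef W y w < 1.
Proof.
by split=> h w wW; have := h w wW; rewrite coef0 ltxx.
Qed.

Lemma dec0_ex W x : full_basis W -> pos W x -> exists y, box_dec W 0 y x.
Proof.
by move=> bW px; apply: dec_ex => // w wW; rewrite coef0 ltxx; split => //; apply: px.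
Qed.

Lemma box0_pos W y : box W 0 y -> pos W y.
Proof. by move=> /box0 h w /h/andP[]. Qed.

Variables (C A Q : set V) (Ws : seq (seq V)).
Hypothesis cC : conic C.
Hypothesis hA : height_one_points C A.
Hypothesis cQ : coset A Q.
Hypothesis tW : triangulation C A Ws.

(** The generic point is existentially quantified so that each argument below may choose its own; by
    [hts_independent] all choices give the same heights. *)
Definition is_height k := exists2 xi, generic_in C Ws xi & box_heights Q Ws xi k.

Lemma box0_eq W W' y : W \in Ws -> W' \in Ws -> pos W' y -> box W 0 y -> box W' 0 y.
Proof.
move=> WW WW' py' by_; have py := box0_pos by_.
move: by_ => /box0 h; apply/box0 => w wW'.
have [e|n0] := eqVneq (coef W' y w) 0; first by rewrite e lexx ltr01.
have cw : 0 < coef W' y w by rewrite lt0r n0 py'.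
have wW := tri_face tW WW' WW py' py wW' cw.
by rewrite -(tri_coef_eq tW WW' WW py' py wW' cw); apply: h.
Qed.

(* Moving [xi0] inside the cone flips the signs of all coordinates outside [Z],
   which makes [Z] the exact set of negative rays of [W]. *)
Lemma is_height_add W y (Z : seq V) xi0 (h : nat) : W \in Ws -> box W 0 y -> Q y ->
  first_coord y = h%:R -> uniq Z -> {subset Z <= W} ->
  (forall w, w \in Z -> coef W y w = 0) ->
  C xi0 -> (forall w, w \in Z -> coef W xi0 w < 0) -> is_height (h + size Z).
Proof.
move=> WW by_ Qy yh uZ ZW Zy Cxi Zxi; have bW := tri_basis tW WW.
have fW := full_free bW.
pose t := 1 + \sum_(w <- W) `|coef W xi0 w|.
have tw w : w \in W -> 0 < t + coef W xi0 w.
  move=> wW; rewrite /t (big_rem w) //=.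
  have : 0 <= \sum_(y0 <- rem w W) `|coef W xi0 y0| by exact: sumr_ge0.
  have : - coef W xi0 w <= `|coef W xi0 w| by rewrite -normrN ler_norm.
  by lra.
pose xi1 := xi0 + \sum_(w <- W) (if w \in Z then 0 else t) *: w.
have co1 w : w \in W -> coef W xi1 w = coef W xi0 w + (if w \in Z then 0 else t).
  by move=> wW; rewrite coefD coef_comb.
have neg1 w : w \in W -> (coef W xi1 w < 0) = (w \in Z).
  move=> wW; rewrite co1 //; case: ifP => [/Zxi|_]; first by rewrite addr0.
  by apply/negbTE; rewrite -leNgt ltW // addrC tw.
have t0 : 0 <= t by rewrite /t addr_ge0 // sumr_ge0.
have [|||xi gxi xiE] := @gen_perturb _ _ C A Ws cC hA tW xi1 W.
- apply: conicD => //; apply: conic_sum => // w wW.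
  apply: conicZ => //; first by case: ifP.
  exact: tri_gen_cone hA tW _ _ WW wW.
- exact: WW.
- move=> w wW; rewrite co1 //; case: ifP => [/Zxi ?|_].
    by rewrite addr0 ltr0_neq0.
  by rewrite addrC lt0r_neq0 ?tw.
(* The coordinates along [Z] are exactly 1, which the interval (0, 1] of a negative ray admits, and
   each element of [Z] adds one to the height. *)
exists xi => //; exists W, (y + \sum_(w <- Z) w); split=> //.
- move=> w wW; rewrite xiE // neg1 // coefD coef_sum_seq // count_uniq_mem //.
  have [wZ|wZ] := boolP (w \in Z); first by rewrite Zy // add0r ltr01 lexx.
  by rewrite addr0; move/box0: by_; apply.
- rewrite (sum_seq_count bW ZW); apply: (cosetD_comb _ cQ) => // w.
  exact: tri_sub tW _ _ WW.
- rewrite first_coordD yh natrD first_coord_sum; congr (_ + _).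
  rewrite -sum1_size natr_sum; apply: eq_big_seq => w /ZW wW.
  by rewrite (hA_one hA) //; apply: tri_sub tW _ _ WW wW.
Qed.

Lemma is_height_reduced W y (h : nat) : W \in Ws -> box W 0 y -> Q y ->
  first_coord y = h%:R -> is_height h.
Proof.
move=> WW by_ Qy yh; rewrite -[h]addn0.
by apply: (@is_height_add W y [::] 0) => //; exact: conic0.
Qed.

Lemma dec_coset W xi y x : W \in Ws -> Q x -> box_dec W xi y x -> Q y.
Proof.
move=> WW Qx [_ [m e]].
have -> : y = x - \sum_(w <- W) (m w)%:R *: w by rewrite e addrK.
by apply: (cosetB_comb _ cQ) Qx => w; apply: tri_sub tW _ _ WW.
Qed.

Section Gap.
Variable k : nat.
Hypothesis gap : ~ is_height k.

Definition lower x := [/\ Q x, C x & first_coord x < k%:R].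

Definition expr x (p : V * seq V) :=
  [/\ lower p.1, {subset p.2 <= flatten Ws} & x = p.1 + \sum_(b <- p.2) b].

Lemma vertex_A b : b \in flatten Ws -> A b.
Proof. by move=> /flattenP[W WW bW]; apply: tri_sub tW _ _ WW bW. Qed.

Lemma first_coord_vertices B : {subset B <= flatten Ws} ->
  first_coord (\sum_(b <- B) b) = (size B)%:R.
Proof.
move=> Bv; rewrite first_coord_sum -sum1_size natr_sum.
by apply: eq_big_seq => b /Bv/vertex_A/(hA_one hA).
Qed.

(** The integer parts of the coordinates in [W] are split off. The remaining box point has height at
    most [k], and the gap excludes height exactly [k]. *)
Lemma reduce W z : W \in Ws -> pos W z -> Q z -> first_coord z <= k%:R ->
  exists y K, [/\ lower y, box W 0 y, {subset K <= W} & z = y + \sum_(b <- K) b].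
Proof.
move=> WW pz Qz zk; have bW := tri_basis tW WW.
have [y dy] := dec0_ex bW pz; have Qy := dec_coset WW Qz dy.
have [by_ [m e]] := dy; have [K KW eK] := nat_comb_seq W m.
have Cy : C y by apply: (pos_cone cC hA tW WW); apply: box0_pos.
exists y, K; split=> //; last by rewrite -eK.
split=> //; have [h yh] := height_nat hA cQ tW Qy Cy.
rewrite yh ltr_nat ltn_neqAle; apply/andP; split.
  apply/negP => /eqP hk; apply: gap; rewrite -hk.
  exact: is_height_reduced WW by_ Qy yh.
rewrite -(ler_nat R) -yh; apply: le_trans zk; rewrite e first_coordD lerDl.
by rewrite (first_coord_comb hA tW) // ler0n.
Qed.

(** Adding [a] to the lower point raises its height to at most [k], so [reduce] brings it back below
    [k] by splitting off further vertices. *)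
Lemma expr_step x p a : A a -> expr x p -> exists p', expr (x + a) p'.
Proof.
case: p => m0 B Aa [[Qm Cm mk] /= Bv ->].
have Cz : C (m0 + a) by apply: conicD => //; apply: (hA_cone hA).
have Qz : Q (m0 + a) by apply: (cosetD cQ).
have [h mh] := height_nat hA cQ tW Qm Cm.
have [W WW pz] := tri_cover tW Cz.
have [|y [K [ly _ KW e]]] := reduce WW pz Qz.
  by rewrite first_coordD (hA_one hA Aa) mh natr1 ler_nat -(ltr_nat R) -mh.
exists (y, K ++ B); split => //=.
  move=> b; rewrite mem_cat => /orP[/KW bW|/Bv//].
  by apply/flattenP; exists W.
by rewrite big_cat /= addrA -e addrAC.
Qed.

Section Minimal.
Variables (f : V -> R) (u : seq V -> V).
Hypothesis fu : forall x W, C x -> W \in Ws ->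
  dot (u W) x <= f x /\ (pos W x <-> f x = dot (u W) x).

Definition cost (p : V * seq V) := f p.1 + \sum_(b <- p.2) f b.

Lemma vertex_cone b : b \in flatten Ws -> C b.
Proof. by move=> /vertex_A/(hA_cone hA). Qed.

(** On a cell [f] coincides with a linear form, so expanding a point within one cell keeps the
    cost. *)
Lemma cost_linear W m0 K : W \in Ws -> pos W m0 -> {subset K <= W} ->
  f m0 + \sum_(b <- K) f b = f (m0 + \sum_(b <- K) b).
Proof.
move=> WW pm KW; have fW := full_free (tri_basis tW WW).
have fE x : pos W x -> f x = dot (u W) x.
  by move=> px; apply: (fu (pos_cone cC hA tW WW px) WW).2.1.
have pb b : b \in K -> pos W b by move=> /KW; apply: pos_gen.
rewrite (fE (m0 + _)); last by apply: posD => //; apply: pos_sum.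
rewrite dotD dot_sum (fE _ pm); congr (_ + _).
by apply: eq_big_seq => b /pb/fE.
Qed.

(** Finitely many expressions compete: the number of vertices is at most the height of [x], and the
    lower point is determined by [x] and the vertices. *)
Lemma expr_min x : (exists p, expr x p) -> exists2 p, expr x p &
  forall p', expr x p' -> cost p <= cost p'.
Proof.
move=> [[m0 B0] e0].
have Cx : C x.
  have [[_ Cm _] /= Bv ->] := e0; apply: conicD => //.
  by apply: conic_sum => // b /Bv/vertex_cone.
have [L hL] := bounded_seqs (flatten Ws) (Num.bound (first_coord x)).
pose P B := expr x (x - \sum_(b <- B) b, B).
have exL m B : expr x (m, B) -> B \in L.
  move=> [[Qm Cm _] /= Bv xE]; apply: hL => //.
  have [h mh] := height_nat hA cQ tW Qm Cm.
  have e : first_coord x = (h + size B)%:R.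
    by rewrite xE first_coordD first_coord_vertices // mh natrD.
  rewrite -(ler_nat R); apply: le_trans (_ : first_coord x <= _).
    by rewrite e ler_nat leq_addl.
  by apply/ltW/archi_boundP; rewrite e.
have exP m B : expr x (m, B) -> m = x - \sum_(b <- B) b.
  by move=> [_ _ /= ->]; rewrite addrK.
have [|B PB hB] := @seq_argmin R _ L P (fun B => cost (x - \sum_(b <- B) b, B)).
  by exists B0; [exact: exL e0 | rewrite /P -(exP _ _ e0)].
exists (x - \sum_(b <- B) b, B) => // -[m' B'] e'.
rewrite (exP _ _ e'); apply: hB; first exact: exL e'.
by rewrite /P -(exP _ _ e').
Qed.

Section MinimalExpr.
Variables (x m0 : V) (B : seq V).
Hypothesis e0 : expr x (m0, B).
Hypothesis min0 : forall p', expr x p' -> cost (m0, B) <= cost p'.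

(** The subsum [z] has height at most [k], so it can be re-expanded in a cell [W] at cost [f z], the
    value at [z] of the linear form of [W]. Minimality bounds the cost of [m0] and [J] by this
    value, while [f] is at least the form at each term. Hence equality holds at each term, and all
    terms lie in the cone on [W]. *)
Lemma min_flat J : uniq J -> {subset J <= B} -> first_coord m0 + (size J)%:R <= k%:R ->
  exists2 W, W \in Ws & pos W m0 /\ {subset J <= W}.
Proof.
move=> uJ JB hJ; have [J' pB] := perm_subset_cat uJ JB.
have [[/= Qm Cm mk] Bv xE] := e0.
have Jv : {subset J <= flatten Ws} by move=> b /JB/Bv.
have J'v : {subset J' <= flatten Ws}.
  by move=> b bJ; apply: Bv; rewrite (perm_mem pB) mem_cat bJ orbT.
set z := m0 + \sum_(b <- J) b.
have Cz : C z by apply: conicD => //; apply: conic_sum => // b /Jv/vertex_cone.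
have Qz : Q z.
  have -> : z = m0 + \sum_(b <- J) 1%N%:R *: b.
    by congr (_ + _); apply: eq_bigr => b _; rewrite scale1r.
  by apply: (cosetD_comb (fun=> 1%N) cQ) Qm => b /Jv/vertex_A.
have [W WW pz] := tri_cover tW Cz.
have [|y [K [ly by_ KW zE]]] := reduce WW pz Qz.
  by rewrite first_coordD first_coord_vertices.
have e' : expr x (y, K ++ J').
  split=> //=.
    move=> b; rewrite mem_cat => /orP[/KW bW|/J'v//].
    by apply/flattenP; exists W.
  by rewrite xE (perm_big _ pB) !big_cat /= !addrA -zE.
have := min0 e'; rewrite /cost /= (perm_big _ pB) !big_cat /= !addrA lerD2r.
rewrite (cost_linear WW (box0_pos by_) KW) -zE.
rewrite ((fu Cz WW).2.1 pz).
rewrite dotD dot_sum => le0.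
have [um um'] := fu Cm WW.
have ub b : b \in J -> 0 <= f b - dot (u W) b.
  by move=> bJ; rewrite subr_ge0; case: (fu (vertex_cone (Jv _ bJ)) WW).
have s0 : 0 <= \sum_(b <- J) (f b - dot (u W) b) by rewrite big_seq sumr_ge0.
have sE : \sum_(b <- J) (f b - dot (u W) b) = \sum_(b <- J) f b - \sum_(b <- J) dot (u W) b.
  by rewrite sumrB.
have m0E : f m0 = dot (u W) m0 by apply/eqP; rewrite eq_le um andbT; lra.
have sz : \sum_(b <- J) (f b - dot (u W) b) = 0 by lra.
exists W => //; split; first by apply/um'.
move=> b bJ; have /flattenP[W' WW' bW'] := Jv _ bJ.
apply: (tri_vertex tW WW' WW bW').
apply: (fu (vertex_cone (Jv _ bJ)) WW).2.2.
have : f b - dot (u W) b = 0; last by move/eqP; rewrite subr_eq0 => /eqP.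
apply/eqP; rewrite eq_le ub // andbT.
move: sz; rewrite (big_rem b) //= => sz.
have : 0 <= \sum_(y0 <- rem b J) (f y0 - dot (u W) y0).
  by rewrite big_seq sumr_ge0 // => c /mem_rem/ub.
by lra.
Qed.

Variable W0 : seq V.
Hypothesis WW0 : W0 \in Ws.
Hypothesis red0 : box W0 0 m0.

Definition good (J : seq V) := exists2 W, W \in Ws & pos W m0 /\ {subset J <= W}.

(** Induction on the size of [J]; up to size [k - h] this is [min_flat]. A larger bad [J = b :: G]
    becomes good on removing any one element, and from this a box point of height [k] is built. *)
Lemma min_good J : uniq J -> {subset J <= B} -> good J.
Proof.
have [n] := ubnP (size J); elim: n J => // n IH J; rewrite ltnS => sJ uJ JB.
have [[/= Qm Cm mk] Bv xE] := e0.
have [h mh] := height_nat hA cQ tW Qm Cm.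
have hk : (h < k)%N by rewrite -(ltr_nat R) -mh.
have [small_J|big_J] := leqP (size J) (k - h).
  by apply: min_flat; rewrite // mh -natrD ler_nat; lia.
have [//|nJ] := pselect (good J); exfalso.
case: J => [|b G] in sJ uJ JB big_J nJ *; first by [].
have goodr g : g \in b :: G -> good (rem g (b :: G)).
  move=> gJ; apply: IH; rewrite ?rem_uniq //; last by move=> c /mem_rem/JB.
  by rewrite size_rem //=; move: sJ; case: (n).
(* If [g] had a positive coordinate in [m0], it would belong to the cell that contains [m0] and the
   rest of [J], making [J] good. *)
have disj g W : g \in b :: G -> W \in Ws -> pos W m0 -> g \in W -> coef W m0 g = 0.
  move=> gJ WW pm gW; apply/eqP; rewrite eq_le pm // andbT leNgt; apply/negP => c0.
  have [W2 WW2 [pm2 rW2]] := goodr g gJ; apply: nJ; exists W2 => //; split=> // c.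
  have [-> _|cg cJ] := eqVneq c g; first exact: (tri_face tW WW WW2 pm pm2).
  by apply: rW2; rewrite (rem_filter _ uJ) mem_filter /= cg.
have bG : b \notin G by case/andP: uJ.
have uG : uniq G by case/andP: uJ.
have [W1 WW1 [pm1 GW1]] : good G by have := goodr b (mem_head _ _); rewrite /= eqxx.
have fW1 := full_free (tri_basis tW WW1).
have Cb : C b by apply/vertex_cone/Bv/JB; rewrite mem_head.
pose p := m0 + \sum_(g <- G) g.
have p1 : pos W1 p.
  by apply: posD => //; apply: pos_sum => g /GW1; apply: pos_gen.
(* [W] is the cell entered from [p] in the direction [b]. It contains [m0] and [G], hence not [b],
   as [J] is bad. *)
have [W WW [pp pb]] := tri_direction cC tW (pos_cone cC hA tW WW1 p1) Cb.
have bW := tri_basis tW WW; have fW := full_free bW.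
have co1 w : w \in W1 -> coef W1 p w = coef W1 m0 w + (w \in G)%:R.
  by move=> wW1; rewrite coefD coef_sum_seq // count_uniq_mem.
have GW : {subset G <= W}.
  move=> g gG; apply: (tri_face tW WW1 WW p1 pp (GW1 _ gG)).
  by rewrite co1 ?GW1 // gG ltr_wpDl ?pm1 ?GW1.
have pm : pos W m0.
  rewrite (coefE m0 (tri_basis tW WW1)) big_seq.
  apply: (big_ind (pos W)); [exact: pos0|exact: posD|move=> w wW1].
  have := pm1 w wW1; rewrite le_eqVlt => /orP[/eqP<-|c0].
    by rewrite scale0r; apply: pos0.
  apply: posZ; [exact: ltW|apply: pos_gen => //].
  apply: (tri_face tW WW1 WW p1 pp wW1).
  by rewrite co1 // ltr_pwDl.
have bnW : b \notin W.
  apply/negP => bW'; apply: nJ; exists W => //; split=> // c.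
  by rewrite inE => /orP[/eqP->|/GW].
have coW w : w \in W -> coef W p w = coef W m0 w + (w \in G)%:R.
  by move=> wW; rewrite coefD coef_sum_seq // count_uniq_mem.
(* Otherwise [q + t *: b] stays in [W] for small [t]: a coordinate vanishing at [q] also vanishes at
   [p], unless it is that of [g]. This point also lies in [Wg], where [b] is a generator with
   positive coordinate, so [b] would belong to [W]. *)
have neg g : g \in G -> coef W b g < 0.
  move=> gG; rewrite ltNge; apply/negP => cg.
  have gJ : g \in b :: G by rewrite inE gG orbT.
  have [Wg WWg [pmg rWg]] := goodr g gJ.
  have bg : b != g by apply: contraNneq bG => ->.
  have rE : rem g (b :: G) = b :: rem g G by rewrite /= (negPf bg).
  have urG : uniq (rem g G) by rewrite rem_uniq.
  have rGW : {subset rem g G <= W} by move=> c /mem_rem/GW.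
  have rGWg : {subset rem g G <= Wg}.
    by move=> c cG; apply: rWg; rewrite rE inE cG orbT.
  have bWg : b \in Wg by apply: rWg; rewrite rE mem_head.
  pose q := m0 + \sum_(c <- rem g G) c.
  have coq w : w \in W -> coef W q w = coef W m0 w + (w \in rem g G)%:R.
    by move=> wW; rewrite coefD coef_sum_seq // count_uniq_mem.
  have : small (fun t => forall w, w \in W -> 0 <= coef W q w + t * coef W b w).
    apply: small_all => w wW; apply: small_affine_ge0.
      by rewrite coq // addr_ge0 ?pm.
    rewrite coq //; have [->//|wg] := eqVneq w g.
    move=> q0; apply: pb => //; rewrite coW //.
    by move: q0; rewrite (rem_filter _ uG) mem_filter /= wg.
  move=> /small_ex[t t0 ht].
  have qW : pos W (q + t *: b) by move=> w wW; rewrite coefD coefZ; apply: ht.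
  have fWg := full_free (tri_basis tW WWg).
  have pbg : pos Wg b by apply: pos_gen.
  have pqg : pos Wg q.
    by apply: posD => //; apply: pos_sum => c /rGWg; apply: pos_gen.
  have qWg : pos Wg (q + t *: b) by apply: posD => //; apply: posZ => //; apply: ltW.
  move/negP: bnW; apply; apply: (tri_face tW WWg WW qWg qW bWg).
  by rewrite coefD coefZ (coef_in fWg bWg bWg) eqxx mulr1 ltr_wpDl ?pqg.
(* The direction [b] is negative on all of [G]; as [J] has more than [k - h] elements, [G] has
   enough of them to raise the height from [h] to [k]. *)
apply: gap; have sG : (k - h <= size G)%N by rewrite -ltnS.
have -> : k = (h + size (take (k - h) G))%N by rewrite size_takel // subnKC // ltnW.
apply: (@is_height_add W m0 (take (k - h) G) b) => //.
- exact: box0_eq WW0 WW pm red0.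
- exact: take_uniq.
- by move=> g /mem_take/GW.
- by move=> g /mem_take gG; apply: disj; rewrite ?inE ?gG ?orbT // GW.
- by move=> g /mem_take/neg.
Qed.

End MinimalExpr.
End Minimal.

(* A cheapest expression of [x], for the cost [f], is its decomposition in a cell. *)
Lemma expr_dec x p : expr x p -> exists W y,
  [/\ W \in Ws, box_dec W 0 y x & first_coord y < k%:R].
Proof.
move=> ep; have [f [u fu]] := tri_regular tW.
have [|[m1 B1] e1 min1] := expr_min f (x := x); first by exists p.
have [[/= Qm Cm mk] Bv xE] := e1.
have [W0 WW0 pm1] := tri_cover tW Cm.
(* [min_good] asks for a reduced lower point, so [m1] is replaced by its box point; the cost is
   unchanged and minimality survives. *)
have [|m0 [K [lm by0 KW mE]]] := reduce WW0 pm1 Qm; first exact: ltW.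
have e0 : expr x (m0, K ++ B1).
  split=> //=; last by rewrite xE mE big_cat addrA.
  move=> b; rewrite mem_cat => /orP[/KW bW|/Bv//].
  by apply/flattenP; exists W0.
have min0 p' : expr x p' -> cost f (m0, K ++ B1) <= cost f p'.
  move=> /min1; rewrite /cost /= big_cat addrA.
  by rewrite (cost_linear fu WW0 (box0_pos by0) KW) -mE.
have [||W WW [pm BW]] := min_good fu e0 min0 WW0 by0 (J := undup (K ++ B1)).
- exact: undup_uniq.
- by move=> b; rewrite mem_undup.
have BW' : {subset K ++ B1 <= W} by move=> b bB; apply: BW; rewrite mem_undup.
exists W, m0; split=> //; last by case: lm.
split; first exact: box0_eq WW0 WW pm by0.
exists (fun w => count_mem w (K ++ B1)).
by rewrite -sum_seq_count //; [case: e0 | exact: tri_basis tW _ WW].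
Qed.

End Gap.
End NoGap.

(** * The heights of box points form an interval of integers *)

Section Interval.
Variables (R : realType) (d : nat).
Local Notation V := 'rV[R]_(1 + d).
Implicit Types (W : seq V) (x y w xi : V).

(** Cramer's rule: [D] is the absolute value of the determinant of the matrix with rows [W], and the
    adjugate gives integral numerators. *)
Lemma lattice_coordinates W a : full_basis W -> (forall w, w \in W -> lattice w) ->
  lattice a -> exists2 D : nat, (0 < D)%N &
    forall w, w \in W -> exists z : int, D%:R * coef W a w = z%:~R.
Proof.
move=> bW lW la; have sW := full_size bW.
have lmx m (M : 'M[R]_(m, 1 + d)) : (forall i j, M i j \is a Num.int) ->
    exists Mz : 'M[int]_(m, 1 + d), M = map_mx intr Mz.
  move=> lM; have z i j : {z : int | M i j = z%:~R} by apply: cid; apply/intrP.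
  by exists (\matrix_(i, j) sval (z i j)); apply/matrixP => i j; rewrite !mxE; case: (z i j).
pose M : 'M[R]_(1 + d) := \matrix_i (nth 0 W i).
pose c x : V := \row_i coef W x (nth 0 W i).
have cM x : x = c x *m M.
  rewrite {1}(coefE x bW) (big_nth 0) big_mkord sW mulmx_sum_row.
  by apply: eq_bigr => i _; rewrite mxE rowK.
have [Mz ME] : exists Mz : 'M[int]_(1 + d), M = map_mx intr Mz.
  apply: lmx => i j; rewrite mxE.
  have /lW/mxOverP : nth 0 W i \in W by rewrite mem_nth // sW.
  exact.
have [az aE] : exists az : 'rV[int]_(1 + d), a = map_mx intr az.
  by apply: lmx; apply/mxOverP.
have det0 : \det M != 0.
  have e : (\matrix_i c (delta_mx ord0 i)) *m M = 1%:M.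
    by apply/row_matrixP => i; rewrite row_mul rowK -cM row1.
  have := congr1 determinant e; rewrite det_mulmx det1 => dM.
  by apply/eqP => M0; move: dM; rewrite M0 mulr0 => /esym/eqP; rewrite oner_eq0.
have detE : \det M = (\det Mz)%:~R by rewrite ME det_map_mx.
have key i : \det M * c a ord0 i = ((az *m \adj Mz) ord0 i)%:~R.
  have : a *m \adj M = \det M *: c a.
    by rewrite {1}(cM a) -mulmxA mul_mx_adj mul_mx_scalar.
  rewrite aE ME -map_mx_adj -map_mxM -ME -aE => /(congr1 (fun N : V => N ord0 i)).
  by rewrite !mxE => <-.
exists (absz (\det Mz)).
  by rewrite absz_gt0; apply: contraNneq det0 => e; rewrite detE e.
move=> w wW; have iw : (index w W < 1 + d)%N by move: (wW); rewrite -index_mem sW.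
have := key (Ordinal iw); rewrite detE !mxE /= nth_index //.
set z := (X in _ = X%:~R) => kz.
case: (\det Mz) kz => n kz; first by exists z.
exists (- z); rewrite intrN -kz NegzE intrN /= mulNr opprK; congr (_ * _).
Qed.

Variables (C A Q : set V) (Ws : seq (seq V)).
Hypothesis cC : conic C.
Hypothesis hA : height_one_points C A.
Hypothesis cQ : coset A Q.
Hypothesis tW : triangulation C A Ws.

Section Conductor.
Variable W : seq V.
Hypothesis WW : W \in Ws.

(** Membership in the monoid generated by [A] after adding a multiple of the sum of [W]. Reachable
    vectors form a monoid; since it contains [A] and [- A], it contains the whole integer span. *)
Definition reachable (g : V) := exists (n : nat) (L : seq V),
  (forall a, a \in L -> A a) /\ g + n%:R *: \sum_(w <- W) w = \sum_(a <- L) a.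

Lemma reachable0 : reachable 0.
Proof. by exists 0%N, [::]; split=> //; rewrite scale0r addr0 big_nil. Qed.

Lemma reachableD g g' : reachable g -> reachable g' -> reachable (g + g').
Proof.
move=> [n [L [LA e]]] [n' [L' [LA' e']]]; exists (n + n')%N, (L ++ L'); split.
  by move=> a; rewrite mem_cat => /orP[/LA|/LA'].
by rewrite big_cat /= -e -e' natrD scalerDl addrACA.
Qed.

Lemma reachable_mulrn g n : reachable g -> reachable (g *+ n).
Proof.
move=> rg; elim: n => [|n IH]; first by rewrite mulr0n; exact: reachable0.
by rewrite mulrS; apply: reachableD.
Qed.

Lemma reachable_mulrz g (z : int) : reachable g -> reachable (- g) -> reachable (g *~ z).
Proof.
move=> rg rg'; case: z => n; first exact: reachable_mulrn.
by rewrite NegzE mulrNz -mulNrz; apply: reachable_mulrn.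
Qed.

Lemma reachable_sum (I : eqType) (r : seq I) (F : I -> V) :
  (forall i, i \in r -> reachable (F i)) -> reachable (\sum_(i <- r) F i).
Proof.
move=> rF; rewrite big_seq; apply: (big_ind reachable) => //.
- exact: reachable0.
- exact: reachableD.
Qed.

Lemma reachable_point a : A a -> reachable a.
Proof.
move=> Aa; exists 0%N, [:: a]; rewrite scale0r addr0 big_seq1; split=> // b.
by rewrite inE => /eqP->.
Qed.

Lemma reachable_opp_gen w : w \in W -> reachable (- w).
Proof.
move=> wW; exists 1%N, (rem w W); split.
  by move=> u /mem_rem; apply: tri_sub tW _ _ WW.
by rewrite scale1r (big_rem w wW) /= addKr.
Qed.

(* [D a] is an integer combination of [W], hence so is [- a] modulo [(D - 1) a]. *)
Lemma reachable_opp a : A a -> reachable (- a).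
Proof.
move=> Aa; have bW := tri_basis tW WW.
have AW w : w \in W -> A w by apply: tri_sub tW _ _ WW.
have [|//|D D0 hD] := lattice_coordinates bW (a := a).
- by move=> w /AW/(hA_lattice hA).
- exact: hA_lattice hA _ Aa.
have [z hz] : exists z : V -> int, forall w, w \in W -> D%:R * coef W a w = (z w)%:~R.
  have : forall w, exists z : int, w \in W -> D%:R * coef W a w = z%:~R.
    move=> w; case: (boolP (w \in W)) => [/hD[z zE]|_]; last by exists 0.
    by exists z.
  by move=> /choice[z hz]; exists z.
have -> : - a = a *+ D.-1 + \sum_(w <- W) w *~ (- z w).
  have aD : a *+ D = \sum_(w <- W) w *~ z w.
    rewrite {1}(coefE a bW) -sumrMnl; apply: eq_big_seq => w wW.
    by rewrite -scaler_nat scalerA hz // scaler_int.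
  rewrite -[D]prednK // mulrS in aD.
  rewrite (eq_bigr (fun w => - (w *~ z w))); last by move=> w _; rewrite mulrNz.
  by rewrite sumrN -aD opprD addrCA subrr addr0.
apply: reachableD; first by apply/reachable_mulrn/reachable_point.
apply: reachable_sum => w wW; apply: reachable_mulrz.
  exact/reachable_point/AW.
exact: reachable_opp_gen.
Qed.

Lemma reachable_int_span g : int_span A g -> reachable g.
Proof.
move=> [m [p [c [pA ->]]]]; apply: reachable_sum => i _.
by apply: reachable_mulrz; [apply: reachable_point | apply: reachable_opp].
Qed.

End Conductor.

Lemma no_gap (a k b : nat) : is_height C Q Ws a -> is_height C Q Ws b ->
  (a < k)%N -> (k < b)%N -> is_height C Q Ws k.
Proof.
move=> [xia gxia [Wa [m [WWa bm Qm ma]]]] [xi gxi [W [y [WW by_ Qy yb]]]] ak kb.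
have [//|gap] := pselect (is_height C Q Ws k); exfalso.
have bW := tri_basis tW WW; have fW := full_free bW.
have py : pos W y by apply: (@hopen_pos _ _ _ xi); apply: dec_hopen (dec_refl by_).
have [y0 dy0] := dec0_ex bW py.
have [by0 [mu yE]] := dy0; have Qy0 := dec_coset cQ tW WW Qy dy0.
have Cy0 : C y0 by apply: (pos_cone cC hA tW WW); apply: box0_pos.
have [h0 yh0] := height_nat hA cQ tW Qy0 Cy0.
(* These are the generators at which [y] has coordinate exactly 1: the coordinates of [y] and [y0]
   differ by 0 or 1, and by 1 only along negative rays. *)
pose Z := [seq w <- W | mu w != 0%N].
have muP w : w \in W -> mu w != 0%N ->
    [/\ mu w = 1%N, coef W y0 w = 0 & coef W xi w < 0].
  move=> wW m0; have m1 : 1 <= (mu w)%:R :> R by rewrite ler1n lt0n.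
  have e : coef W y w = coef W y0 w + (mu w)%:R by rewrite yE coefD coef_comb.
  move/box0: by0 => /(_ w wW) h; have := by_ w wW.
  case: ifP => xw h'; last by lra.
  have e1 : (mu w)%:R = 1 :> R by lra.
  split=> //; last by lra.
  by move/eqP: e1; rewrite pnatr_eq1 => /eqP.
have muZ w : w \in W -> mu w = count_mem w Z.
  move=> wW; rewrite count_uniq_mem ?filter_uniq ?full_uniq // mem_filter wW andbT.
  by case: eqP => [->//|/eqP/(muP w wW)[-> _ _]].
have ZW : {subset Z <= W} by move=> w; rewrite mem_filter => /andP[].
have yE' : y = y0 + \sum_(w <- Z) w.
  rewrite yE (sum_seq_count bW ZW); congr (_ + _).
  by apply: eq_big_seq => w wW; rewrite muZ.
have sZ : b = (h0 + size Z)%N.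
  apply/eqP; rewrite -(eqr_nat R) -yb yE' first_coordD yh0 natrD.
  rewrite first_coord_sum -sum1_size natr_sum; apply/eqP; congr (_ + _).
  apply: eq_big_seq => w /ZW wW; rewrite (hA_one hA) //.
  exact: tri_sub tW _ _ WW wW.
(* If [h0 < k], adding only [k - h0] elements of [Z] to [y0] reaches height [k]. If [h0 > k], then
   [y0] plus enough generators has an expression starting from [m], so its box point has height
   below [k]. If they are equal, [y0] itself has height [k]. *)
have [h0k|kh0|h0k] := ltngtP h0 k.
- apply: gap; have -> : k = (h0 + size (take (k - h0) Z))%N.
    by rewrite size_takel; lia.
  apply: (@is_height_add _ _ C A Q Ws cC hA cQ tW W y0 _ xi) => //.
  + by rewrite take_uniq // filter_uniq // full_uniq.
  + by move=> w /mem_take/ZW.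
  + by move=> w /mem_take; rewrite mem_filter => /andP[m0 wW]; case: (muP w wW m0).
  + by case: gxi.
  + by move=> w /mem_take; rewrite mem_filter => /andP[m0 wW]; case: (muP w wW m0).
- have Cm : C m.
    apply: (pos_cone cC hA tW WWa); apply: (@hopen_pos _ _ _ xia).
    exact: dec_hopen (tri_basis tW WWa) (dec_refl bm).
  have [n [L [LA eL]]] := reachable_int_span WW (coset_diff cQ Qy0 Qm).
  have stepL (K : seq V) x p : (forall c, c \in K -> A c) -> expr C Q Ws k x p ->
      exists p', expr C Q Ws k (x + \sum_(c <- K) c) p'.
    elim: K x p => [|c K IH] x p KA ep; first by exists p; rewrite big_nil addr0.
    have [|p' ep'] := expr_step cC hA cQ tW gap _ ep (a := c).
      by apply: KA; rewrite mem_head.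
    rewrite big_cons addrA; apply: IH ep' => e eK.
    by apply: KA; rewrite inE eK orbT.
  (* The extra copy of [W] makes every coordinate of the sum in [W] positive, even when [n] is 0, so
     any cell containing the sum has the generators of [W]. *)
  have [||p ep] := stepL (L ++ W) m (m, [::]).
  + move=> c; rewrite mem_cat => /orP[/LA//|].
    exact: tri_sub tW _ _ WW.
  + split=> //=; last by rewrite big_nil addr0.
    by split=> //; rewrite ma ltr_nat.
  have [W' [y' [WW' dy' y'k]]] := expr_dec cC hA cQ tW gap ep.
  have xE : m + \sum_(c <- L ++ W) c = y0 + n.+1%:R *: \sum_(w <- W) w.
    rewrite big_cat /= -eL -natr1 scalerDl scale1r !addrA.
    by rewrite [m + y0]addrC addrK.
  rewrite xE in dy'; set x := (X in box_dec _ _ _ X) in dy'.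
  have dx : box_dec W 0 y0 x by split=> //; exists (fun=> n.+1); rewrite /x scaler_sumr.
  have px' : pos W' x by apply: (@hopen_pos _ _ _ 0); apply: dec_hopen dy'; exact: tri_basis tW _ WW'.
  have px : pos W x by apply: (@hopen_pos _ _ _ 0); apply: dec_hopen dx.
  have sub : {subset W <= W'}.
    move=> w wW; apply: (tri_face tW WW WW' px px' wW).
    rewrite coefD scaler_sumr (coef_comb (fun=> _)) // ltr_wpDl ?ltr0n //.
    exact: box0_pos by0 _ wW.
  have bW' := tri_basis tW WW'.
  have eW : W =i W'.
    apply: (uniq_min_size (full_uniq bW) sub _).2.
    by rewrite (full_size bW) (full_size bW').
  have e := dec_uniq bW dx (dec_eqi bW bW' eW dy').
  by move: y'k; rewrite -e yh0 ltr_nat => /ltn_trans/(_ kh0); rewrite ltnn.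
- by apply: gap; rewrite -h0k; apply: (is_height_reduced cC hA cQ tW) WW by0 Qy0 yh0.
Qed.

(** Translating [v] into a cell yields some height, and all heights are at most [1 + d] since box
    coordinates are at most 1. Then [no_gap] fills in everything between the least and the
    greatest. *)
Lemma is_height_interval v : Q v -> exists a b : nat, (a <= b)%N /\
  forall k, is_height C Q Ws k <-> (a <= k <= b)%N.
Proof.
move=> Qv; pose P k := `[< is_height C Q Ws k >].
have [W WW _] := tri_cover tW (conic0 cC).
have bW := tri_basis tW WW; have fW := full_free bW.
have exP : exists k, P k.
  pose n := Num.bound (\sum_(w <- W) `|coef W v w|).
  pose x := v + \sum_(w <- W) n%:R *: w.
  have px : pos W x.
    move=> w wW; rewrite coefD (coef_comb (fun=> _)) // -lerBlDl sub0r.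
    apply: le_trans (ltW (archi_boundP _)); last by rewrite sumr_ge0.
    rewrite (big_rem w) //=; apply: ler_wpDr; first by rewrite sumr_ge0.
    by rewrite -normrN ler_norm.
  have Qx : Q x by apply: (cosetD_comb _ cQ) Qv => w; apply: tri_sub tW _ _ WW.
  have [y dy] := dec0_ex bW px; have Qy := dec_coset cQ tW WW Qx dy.
  have by_ : box W 0 y by case: dy.
  have [|h yh] := height_nat hA cQ tW Qy.
    by apply: (pos_cone cC hA tW WW); apply: box0_pos.
  by exists h; apply/asboolP; apply: (is_height_reduced cC hA cQ tW) WW by_ Qy yh.
have boundP k : P k -> (k <= 1 + d)%N.
  move=> /asboolP[xi gxi [W' [y [WW' by_ Qy yk]]]].
  have sW' := full_size (tri_basis tW WW').
  rewrite -(ler_nat R) -yk (first_coord_coef hA tW _ WW').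
  apply: le_trans (_ : (size W')%:R <= _); last by rewrite sW'.
  rewrite -sum1_size natr_sum big_seq [leRHS]big_seq.
  by apply: ler_sum => w wW; have := by_ w wW; case: ifP => _ /andP[]; lra.
case: (ex_minnP exP) => a Pa mina; case: (ex_maxnP exP boundP) => b Pb maxb.
exists a, b; split; first exact: mina.
move=> k; split=> [hk|].
  by rewrite mina ?maxb //; apply/asboolP.
move=> /andP[]; rewrite leq_eqVlt => /orP[/eqP<- _|ak]; first exact/asboolP.
rewrite leq_eqVlt => /orP[/eqP->|kb]; first exact/asboolP.
by apply: no_gap ak kb; apply/asboolP.
Qed.

End Interval.

(** * Cones, their faces and their primitive ray generators *)

Section Hulls.
Variables (R : realType) (d : nat).
Local Notation V := 'rV[R]_(1 + d).
Implicit Types (S C : set V) (W X : seq V) (x y w : V).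

Lemma cone_hull_gen S x : S x -> cone_hull S x.
Proof.
move=> Sx; exists 1%N, (fun=> x), (fun=> 1); split=> //.
by rewrite big_ord1 scale1r.
Qed.

Lemma conic_cone_hull S : conic (cone_hull S).
Proof.
split.
- by exists 0%N, (fun=> 0), (fun=> 0); split=> [[]|[]|] //; rewrite big_ord0.
- move=> x y [m [p [c [pS c0 ->]]]] [m' [p' [c' [pS' c0' ->]]]].
  exists (m + m')%N, (fun i => match fintype.split i with inl j => p j | inr j => p' j end),
    (fun i => match fintype.split i with inl j => c j | inr j => c' j end); split.
  + by move=> i; case: fintype.splitP.
  + by move=> i; case: fintype.splitP.
  + rewrite big_split_ord /=; congr (_ + _); apply: eq_bigr => i _.
      by rewrite (unsplitK (inl i)).
    by rewrite (unsplitK (inr i)).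
- move=> t x t0 [m [p [c [pS c0 ->]]]]; exists m, p, (fun i => t * c i); split=> //.
    by move=> i; rewrite mulr_ge0.
  by rewrite scaler_sumr; apply: eq_bigr => i _; rewrite scalerA.
Qed.

Lemma cone_hull_sub S C : conic C -> S `<=` C -> cone_hull S `<=` C.
Proof.
move=> cC SC x [m [p [c [pS c0 ->]]]]; apply: conic_sum => // i _.
by apply: conicZ => //; apply: SC.
Qed.

Lemma int_spanD S x y : int_span S x -> int_span S y -> int_span S (x + y).
Proof.
move=> [m [p [c [pS ->]]]] [m' [p' [c' [pS' ->]]]].
exists (m + m')%N, (fun i => match fintype.split i with inl j => p j | inr j => p' j end),
  (fun i => match fintype.split i with inl j => c j | inr j => c' j end); split.
  by move=> i; case: fintype.splitP.
rewrite big_split_ord /=; congr (_ + _); apply: eq_bigr => i _.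
  by rewrite (unsplitK (inl i)).
by rewrite (unsplitK (inr i)).
Qed.

Lemma int_spanN S x : int_span S x -> int_span S (- x).
Proof.
move=> [m [p [c [pS ->]]]]; exists m, p, (fun i => - c i); split=> //.
by rewrite -sumrN; apply: eq_bigr => i _; rewrite mulrNz.
Qed.

Lemma int_span_gen S x : S x -> int_span S x.
Proof.
by move=> Sx; exists 1%N, (fun=> x), (fun=> 1); split=> //; rewrite big_ord1 mulr1z.
Qed.

Lemma latticeD x y : lattice x -> lattice y -> lattice (x + y).
Proof.
move=> /mxOverP lx /mxOverP ly; apply/mxOverP => i j.
by rewrite mxE rpredD.
Qed.

Lemma int_span_lattice S : S `<=` @lattice R (1 + d) -> int_span S `<=` @lattice R (1 + d).
Proof.
move=> SL x [m [p [c [pS ->]]]].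
apply/mxOverP => i j; rewrite summxE rpred_sum // => k _.
by rewrite -scaler_int mxE rpredM ?intr_int //; have /mxOverP := SL _ (pS k); apply.
Qed.

Lemma coneP X x : free X ->
  cone_hull [set` X] x <-> x \in <<X>>%VS /\ pos X x.
Proof.
move=> fX; split.
  suff : conic [set x | x \in <<X>>%VS /\ pos X x].
    move=> /cone_hull_sub; apply => w /= wX.
    by split; [apply: memv_span | apply: pos_gen].
  split=> [|y z [yX py] [zX pz]|t y t0 [yX py]] /=.
  - by split; [exact: mem0v | exact: pos0].
  - by split; [exact: memvD | exact: posD].
  - by split; [exact: memvZ | exact: posZ].
move=> [xX px]; rewrite (coef_span xX fX).
apply: conic_sum => [|w wX]; first exact: conic_cone_hull.
by apply: conicZ; [exact: conic_cone_hull | exact: px | exact: cone_hull_gen].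
Qed.

Lemma cone1P w x : cone_hull [set w] x <-> exists2 t, 0 <= t & x = t *: w.
Proof.
split=> [[m [p [c [pw c0 ->]]]]|[t t0 ->]].
  exists (\sum_i c i); first exact: sumr_ge0.
  by rewrite scaler_suml; apply: eq_bigr => i _; rewrite pw.
apply: conicZ => //; [exact: conic_cone_hull | exact: cone_hull_gen].
Qed.

Lemma dot_coef X (c : V -> R) : exists u : V, forall x,
  dot u x = \sum_(w <- X) c w * coef X x w.
Proof.
exists (\row_i \sum_(w <- X) c w * coef X (delta_mx ord0 i) w) => x.
rewrite {2}(row_sum_delta x) /dot.
under eq_bigr do rewrite mxE mulr_suml.
rewrite exchange_big /=; apply: eq_bigr => w _.
rewrite coef_sum mulr_sumr; apply: eq_bigr => i _.
by rewrite coefZ -mulrA [coef _ _ _ * _]mulrC.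
Qed.

(** The supporting functional is the sum of the coordinates at the generators outside [p]. *)
Lemma cone_face X (p : pred V) : free X ->
  is_face (cone_hull [set` [seq w <- X | p w]]) (cone_hull [set` X]).
Proof.
move=> fX; have fXp := filter_free p fX.
have [u uE] := dot_coef X (fun w => (~~ p w)%:R); exists u.
  move=> x /(coneP _ fX)[_ px]; rewrite uE big_seq sumr_ge0 // => w wX.
  by rewrite mulr_ge0 ?px.
apply/seteqP; split=> x /=.
  move=> hx; split.
    apply: cone_hull_sub hx; first exact: conic_cone_hull.
    by move=> w /=; rewrite mem_filter => /andP[_ wX]; apply: cone_hull_gen.
  move: hx => [m [q [c [qX c0 ->]]]]; rewrite uE big1_seq // => w /= wX.
  rewrite coef_sum mulr_sumr big1 // => i _; rewrite coefZ.
  have := qX i; rewrite /= mem_filter => /andP[pq qiX].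
  by rewrite coef_in //; case: eqP => [<-|]; rewrite ?pq ?mul0r ?mulr0.
move=> [/(coneP _ fX)[xX px]]; rewrite uE => s0.
have coef0 w : w \in X -> ~~ p w -> coef X x w = 0.
  move=> wX pw; apply/eqP; rewrite eq_le px // andbT.
  move: s0; rewrite (big_rem w) //= pw mul1r => s0.
  have : 0 <= \sum_(y <- rem w X) (~~ p y)%:R * coef X x y.
    by rewrite big_seq sumr_ge0 // => y /mem_rem yX; rewrite mulr_ge0 ?px.
  by lra.
rewrite (coef_span xX fX) (bigID p) /= [X in _ + X]big1_seq ?addr0; last first.
  by move=> w /andP[pw wX]; rewrite coef0 // scale0r.
rewrite -big_filter; apply: conic_sum => [|w wX]; first exact: conic_cone_hull.
apply: conicZ; [exact: conic_cone_hull | | exact: cone_hull_gen].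
by apply: px; move: wX; rewrite mem_filter => /andP[].
Qed.

Lemma lin_span_cone X : free X -> lin_span (cone_hull [set` X]) = [set` <<X>>%VS].
Proof.
move=> fX; apply/seteqP; split=> x /=.
  move=> [m [p [c [pX ->]]]]; apply: memv_suml => i _; apply: memvZ.
  by have /(coneP _ fX)[] := pX i.
move=> xX; rewrite (coef_span xX fX) (big_nth 0) big_mkord.
exists (size X), (fun i => nth 0 X i), (fun i => coef X x (nth 0 X i)); split=> // i.
by apply: cone_hull_gen; rewrite /= mem_nth.
Qed.

Lemma has_lin_dim_cone X k : free X ->
  has_lin_dim (cone_hull [set` X]) k <-> size X = k.
Proof.
move=> fX; rewrite /has_lin_dim lin_span_cone //; split.
  move=> [U XU <-]; have -> : U = <<X>>%VS.
    apply/vspaceP => x; apply/idP/idP => h.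
      by have : [set` U] x by []; rewrite -XU.
    by have : [set` <<X>>%VS] x by []; rewrite XU.
  by move: fX => /eqP.
by move=> <-; exists <<X>>%VS => //; apply/eqP.
Qed.

Lemma free_scale X (f : V -> V) : free X ->
  (forall x, x \in X -> exists2 t, t != 0 & x = t *: f x) -> free [seq f x | x <- X].
Proof.
elim: X => [|a X IH] //=; rewrite !free_cons => /andP[aX fX] hf.
have hX x : x \in X -> exists2 t, t != 0 & x = t *: f x.
  by move=> xX; apply: hf; rewrite inE xX orbT.
rewrite IH // andbT; apply: contra aX => fa.
have [t t0 ->] := hf a (mem_head _ _); apply: memvZ.
have /subvP : (<<[seq f x | x <- X]>> <= <<X>>)%VS; last exact.
apply/span_subvP => _ /mapP[x xX ->].
have [s s0 e] := hX x xX; have -> : f x = s^-1 *: x.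
  by rewrite {2}e scalerA mulVf // scale1r.
by apply/memvZ/memv_span.
Qed.

(** Induction on the exponent of a power of 2 exceeding the l1-norm [N x]: a nonzero lattice vector
    that is not primitive is [k >= 2] times a lattice vector, whose norm is at most half, and
    nonzero lattice vectors have norm at least 1. *)
Lemma primitive_ex x : lattice x -> x != 0 ->
  exists2 u, primitive u & exists2 k : nat, (0 < k)%N & x = k%:R *: u.
Proof.
pose N y : R := \sum_i `|y ord0 i|.
have [n] : exists n : nat, N x < (2 ^ n)%:R.
  have N0 : 0 <= N x by exact: sumr_ge0.
  exists (Num.bound (N x)); apply: lt_trans (archi_boundP N0) _.
  by rewrite ltr_nat ltn_expl.
have N1 y : lattice y -> y != 0 -> 1 <= N y.
  move=> /mxOverP ly y0.
  have [i yi] : exists i, y ord0 i != 0.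
    apply/existsP; apply: contraNT y0; rewrite negb_exists => /forallP h.
    by apply/eqP/rowP => i; rewrite mxE; apply/eqP; move: (h i); rewrite negbK.
  rewrite /N (bigD1 i) //=; apply: ler_wpDr; first exact: sumr_ge0.
  exact: norm_intr_ge1.
elim: n x => [|n IH] x xn lx x0; first by have := N1 x lx x0; lra.
have [px|/not_andP[//|]] := pselect (primitive x).
  by exists x => //; exists 1%N => //; rewrite scale1r.
move=> /existsNP[k] /existsNP[u] /not_implyP[lu] /not_implyP[xE k1].
have u0 : u != 0 by apply: contraNneq x0 => u0; rewrite xE u0 scaler0.
have k0 : k != 0%N by apply: contraNneq x0 => k0; rewrite xE k0 scale0r.
have k2 : 2 <= k%:R :> R.
  by rewrite ler_nat; case: k k0 k1 {xE} => [|[|k]].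
have Nx : N x = k%:R * N u.
  by rewrite /N mulr_sumr; apply: eq_bigr => i _; rewrite xE mxE normrM normr_nat.
have [|//|//|u' pu' [k' k'0 uE]] := IH u.
  have : 2 * N u <= N x by rewrite Nx ler_wpM2r // sumr_ge0.
  by move: xn; rewrite expnS natrM; lra.
exists u' => //; exists (k * k')%N; first by rewrite muln_gt0 lt0n k0.
by rewrite xE uE scalerA natrM.
Qed.

Lemma primitive_neq0 w : primitive w -> w != 0.
Proof.
move=> [lw hw]; apply/eqP => w0.
by have := hw 2%N w lw; rewrite w0 scaler0 => /(_ erefl).
Qed.

(** The given generators are replaced by primitive ones on the same rays. Conversely, let [w]
    generate the ray cut out by [u]: as [u] is nonnegative on [W] and vanishes at [w], it vanishes
    at any [v] of [W] with positive coefficient in [w]. So [v] lies on the ray of [w], and equal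
    heights give [v = w]. *)
Lemma simplicial_ray_gens (s : set V) : rational_simplicial_cone s ->
  (forall w, ray_gens s w -> first_coord w = 1) ->
  exists W, [/\ free W, s = cone_hull [set` W] & ray_gens s = [set` W]].
Proof.
move=> [X [fX lX] sE] h1.
have [f hf] : exists f : V -> V, forall x, x \in X ->
    primitive (f x) /\ exists2 k : nat, (0 < k)%N & x = k%:R *: f x.
  have : forall x, exists u, x \in X ->
      primitive u /\ exists2 k : nat, (0 < k)%N & x = k%:R *: u.
    move=> x; have [xX|_] := boolP (x \in X); last by exists 0.
    have [|u pu hk] := primitive_ex (lX x xX); first exact: free_not0 fX xX.
    by exists u.
  by move=> /choice[f hf]; exists f.
pose W := [seq f x | x <- X].
have fW : free W.
  apply: free_scale => // x /hf[_ [k k0 xE]]; exists k%:R => //.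
  by rewrite pnatr_eq0 -lt0n.
have sW : s = cone_hull [set` W].
  rewrite sE; apply/seteqP; split; apply: cone_hull_sub; try exact: conic_cone_hull.
    move=> x /= xX; have [_ [k k0 ->]] := hf x xX.
    apply: conicZ; [exact: conic_cone_hull|exact: ler0n|].
    by apply: cone_hull_gen; rewrite /= map_f.
  move=> _ /= /mapP[x xX ->]; have [_ [k k0 xE]] := hf x xX.
  have -> : f x = k%:R^-1 *: x.
    by rewrite {2}xE scalerA mulVf ?scale1r // pnatr_eq0 -lt0n.
  apply: conicZ; [exact: conic_cone_hull|by rewrite invr_ge0 ler0n|].
  exact: cone_hull_gen.
have WR w : w \in W -> ray_gens s w.
  move=> wW; split; first by move: wW => /mapP[x /hf[px _] ->].
  have := cone_face (pred1 w) fW; rewrite -sW.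
  suff -> : [set` [seq u <- W | pred1 w u]] = [set w] by [].
  apply/seteqP; split=> u /=; rewrite mem_filter; first by case/andP => /eqP.
  by move=> ->; rewrite /= eqxx.
exists W; split=> //; apply/seteqP; split=> w /=; last exact: WR.
move=> rw; have [pw [u u0 fE]] := rw.
have w0 := primitive_neq0 pw.
have : cone_hull [set w] w by exact: cone_hull_gen.
rewrite fE => -[/= sw uw]; move: sw; rewrite sW => /(coneP _ fW)[wW pos_w].
have wE := coef_span wW fW.
have [v vW cv] : exists2 v, v \in W & coef W w v != 0.
  apply/hasP; apply: contraNT w0 => /hasPn h; rewrite wE big1_seq // => v /= vW.
  by have := h v vW; rewrite negbK => /eqP->; rewrite scale0r.
have cv0 : 0 < coef W w v by rewrite lt0r cv pos_w.
have uv0 v' : v' \in W -> 0 <= dot u v'.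
  by move=> v'W; apply: u0; case: (WR v' v'W) => _ _; rewrite sW; apply: cone_hull_gen.
have uv : dot u v = 0.
  move: uw; rewrite {1}wE dot_sum (big_rem v) //= dotZ => e.
  have r0 : 0 <= \sum_(y <- rem v W) dot u (coef W w y *: y).
    rewrite big_seq sumr_ge0 // => y /mem_rem yW.
    by rewrite dotZ mulr_ge0 ?pos_w ?uv0.
  have : coef W w v * dot u v <= 0 by lra.
  rewrite pmulr_rle0 // => uv; apply/eqP.
  by rewrite eq_le uv uv0.
have : cone_hull [set w] v.
  by rewrite fE; split=> //; rewrite sW; apply: cone_hull_gen.
move=> /cone1P[t _ vE].
have := h1 _ (WR v vW); rewrite vE first_coordZ (h1 _ rw) mulr1 => t1.
by move: vW; rewrite vE t1 scale1r.
Qed.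

End Hulls.

(** * The cone over the polytope, and the passage from its fans to lists of bases *)

Section Polytope.
Variables (R : realType) (d : nat) (P : set 'rV[R]_d).
Local Notation V := 'rV[R]_(1 + d).
Hypothesis P_lattice : lattice_polytope P.
Hypothesis P_dim : has_aff_dim P d.

Definition lattice_points : set V := height_one P `&` @lattice R (1 + d).

Lemma height_one_first_coord (S : set 'rV[R]_d) x : height_one S x -> first_coord x = 1.
Proof. by move=> [p _ <-]; rewrite /first_coord row_mxEl mxE. Qed.

Lemma conic_cone_over : conic (cone_over P).
Proof. exact: conic_cone_hull. Qed.

Lemma height_one_lattice_points : height_one_points (cone_over P) lattice_points.
Proof.
split=> [a [aP _]|a []//|a [/height_one_first_coord]//].
exact: cone_hull_gen.
Qed.

Lemma sum_height_one m (q : 'I_m -> 'rV[R]_d) (c : 'I_m -> R) :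
  \sum_i c i *: row_mx (const_mx 1 : 'rV_1) (q i) =
  row_mx (const_mx (\sum_i c i)) (\sum_i c i *: q i).
Proof.
elim/big_rec3: _ => [|i w u s _ ->].
  have -> : const_mx 0 = 0 :> 'rV[R]_1 by apply/rowP => j; rewrite !mxE.
  by rewrite row_mx0.
rewrite scale_row_mx add_row_mx; congr row_mx.
by apply/rowP => j; rewrite !mxE mulr1.
Qed.

(** The first coordinate of a combination of lifted points is the sum of its coefficients, so height
    one makes the combination convex. *)
Lemma cone_over_height_one x : cone_over P x -> first_coord x = 1 -> height_one P x.
Proof.
have [S _ PE] := P_lattice.
have sub : cone_over P `<=` cone_hull (height_one S).
  apply: cone_hull_sub; first exact: conic_cone_hull.
  move=> _ [p + <-]; rewrite PE => -[m [q [c [qS c0 c1 ->]]]].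
  rewrite -c1 -sum_height_one; apply: conic_sum => [|i _]; first exact: conic_cone_hull.
  apply: conicZ; [exact: conic_cone_hull | exact: c0 | apply: cone_hull_gen].
  by exists (q i).
move=> /sub[m [p [c [pS c0 xE]]]] x1.
have [q hq] : exists q : 'I_m -> 'rV[R]_d, forall i,
    S (q i) /\ row_mx (const_mx 1) (q i) = p i.
  have : forall i, exists q, S q /\ row_mx (const_mx 1) q = p i.
    by move=> i; have [q Sq qp] := pS i; exists q.
  by move=> /choice[q hq]; exists q.
have e : x = row_mx (const_mx (\sum_i c i)) (\sum_i c i *: q i).
  by rewrite -sum_height_one xE; apply: eq_bigr => i _; case: (hq i) => _ ->.
have s1 : \sum_i c i = 1.
  by move: x1; rewrite e /first_coord row_mxEl mxE.
exists (\sum_i c i *: q i); last by rewrite e s1.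
by rewrite PE; exists m, q, c; split=> // i; case: (hq i).
Qed.

(** Differences of lifted points span all vectors of height 0 because [P] is full-dimensional, and
    one lifted point supplies the remaining direction. *)
Lemma cone_over_spans (U : {vspace V}) : cone_over P `<=` [set` U] -> U = fullv.
Proof.
move=> CU; have [x0 Px0 [U' spanU dimU]] := P_dim.
have U'T : U' = fullv.
  by apply/eqP; rewrite eqEdim subvf /= dimU dimvf /dim /= mul1n.
have PU p : P p -> row_mx (const_mx 1 : 'rV_1) p \in U.
  by move=> Pp; apply: CU; apply: cone_hull_gen; exists p.
have ZU y : row_mx (0 : 'rV_1) y \in U.
  have : lin_span [set x - x0 | x in P] y by rewrite spanU U'T /= memvf.
  move=> [m [p [c [pP ->]]]].
  have -> : row_mx (0 : 'rV_1) (\sum_i c i *: p i) = \sum_i c i *: row_mx 0 (p i).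
    elim/big_rec2: _ => [|i u s _ <-]; first by rewrite row_mx0.
    by rewrite scale_row_mx add_row_mx scaler0 addr0.
  apply: memv_suml => i _; apply: memvZ; have [q Pq <-] := pP i.
  have -> : row_mx (0 : 'rV_1) (q - x0) = row_mx (const_mx 1) q - row_mx (const_mx 1) x0.
    by rewrite opp_row_mx add_row_mx subrr.
  by rewrite memvB ?PU.
apply/vspaceP => x; rewrite memvf -(hsubmxK x).
have -> : row_mx (lsubmx x) (rsubmx x) = first_coord x *: row_mx (const_mx 1) x0 +
    row_mx 0 (rsubmx x - first_coord x *: x0).
  rewrite scale_row_mx add_row_mx addr0 addrC subrK; congr row_mx.
  by apply/rowP => i; rewrite !mxE mulr1 ord1.
by rewrite memvD ?memvZ ?PU.
Qed.

Lemma coset_Gamma (v : V) : lattice v ->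
  coset lattice_points [set v + g | g in Gamma P].
Proof.
move=> lv; split.
- move=> _ [g Gg <-]; apply: latticeD => //.
  by apply: int_span_lattice Gg => a [].
- move=> _ a [g Gg <-] Aa; exists (g + a); last by rewrite addrA.
  by apply: int_spanD => //; apply: int_span_gen.
- move=> _ a [g Gg <-] Aa; exists (g - a); last by rewrite addrA.
  by apply: int_spanD => //; apply/int_spanN/int_span_gen.
- move=> _ _ [g Gg <-] [g' Gg' <-]; rewrite [v + g]addrC addrKA.
  by apply: int_spanD => //; apply: int_spanN.
Qed.

Section Fan.
Variable T : set (set V).
Hypothesis UT : Upsilon (cone_over P) T.
Local Notation C := (cone_over P).

Lemma fan_gens : exists g : set V -> seq V, forall s, T s ->
  [/\ free (g s), s = cone_hull [set` g s] & ray_gens s = [set` g s]].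
Proof.
have [[_ simT _ _ _] _ h1] := UT.
have : forall s, exists W, T s ->
    [/\ free W, s = cone_hull [set` W] & ray_gens s = [set` W]].
  move=> s; have [Ts|nTs] := pselect (T s); last by exists [::].
  have [|W hW] := simplicial_ray_gens (simT s Ts); last by exists W.
  by move=> w; apply: h1.
by move=> /choice[g gP]; exists g.
Qed.

Variable g : set V -> seq V.
Hypothesis gP : forall s, T s ->
  [/\ free (g s), s = cone_hull [set` g s] & ray_gens s = [set` g s]].

Lemma gen_lattice_point s w : T s -> w \in g s -> lattice_points w.
Proof.
move=> Ts wg; have [fW sE rE] := gP Ts.
have [_ _ h1] := UT; have [[_ _ _ _ cov] _ _] := UT.
have rw : ray_gens s w by rewrite rE.
split; last by case: rw => -[].
apply: cone_over_height_one; last exact: h1 rw.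
rewrite -cov; exists s => //; rewrite sE; exact: cone_hull_gen.
Qed.

Lemma cell_full s : cells T (1 + d) s -> full_basis (g s).
Proof.
move=> [Ts dim_s]; have [fW sE rE] := gP Ts; split=> //.
rewrite dimvf /dim /= mul1n; apply/has_lin_dim_cone => //.
by rewrite -sE.
Qed.

Lemma cell_pos s x : cells T (1 + d) s -> pos (g s) x <-> s x.
Proof.
move=> cs; have [Ts _] := cs; have [fW sE _] := gP Ts.
rewrite {2}sE coneP // full_span; last exact: cell_full.
by rewrite memvf; split=> [|[]].
Qed.

Lemma maximal_cells : exists Ws : seq (seq V), forall W,
  W \in Ws <-> exists2 s, cells T (1 + d) s & W = g s.
Proof.
have [[finT _ _ _ _] _ _] := UT.
have : finite_set (cells T (1 + d)) by apply: sub_finite_set finT => s [].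
move=> /finite_seqP[L LE]; exists [seq g s | s <- L] => W; split.
  by move=> /mapP[s sL ->]; exists s => //; rewrite LE.
by move=> [s cs ->]; apply: map_f; move: cs; rewrite LE.
Qed.

(* Push [x] into the cone along a direction that avoids the spans of the
   lower-dimensional cells. *)
Lemma maximal_cover x : C x -> exists2 s, cells T (1 + d) s & s x.
Proof.
move=> Cx; have [[finT _ _ _ cov] _ _] := UT.
have [L LE] := (finite_seqP _).1 finT.
have TL s : s \in L <-> T s by rewrite LE.
have [||eta Ceta heta] := @conic_avoid _ _ C _
  [seq s <- L | size (g s) != d.+1] (fun s => [set` <<g s>>%VS]) conic_cone_over.
- by move=> s t y z /= ys zs; rewrite memvD ?memvZ.
- move=> s; rewrite mem_filter => /andP[sz sL].
  have Ts := (TL s).1 sL; have [fW sE _] := gP Ts.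
  apply: contrapT => nc; move/eqP: sz; apply.
  have e : <<g s>>%VS = fullv.
    apply: cone_over_spans => c Cc; apply: contrapT => nin.
    by apply: nc; exists c.
  by move: fW => /eqP <-; rewrite e dimvf /dim /= mul1n.
have [|s sL fs] := @pigeonhole R _ L (fun s t => s (x + t *: eta)).
  exists 1 => // t /andP[t0 _].
  have : C (x + t *: eta).
    by apply: conicD => //; [exact: conic_cone_over | apply: conicZ => //;
      [exact: conic_cone_over | exact: ltW]].
  by rewrite -cov => -[s Ts sx]; exists s => //; apply/TL.
have Ts := (TL s).1 sL; have [fW sE _] := gP Ts.
have sz : size (g s) = d.+1.
  apply/eqP; apply: contrapT => /negP nsz.
  apply: (heta s); first by rewrite mem_filter nsz.
  have [t1 /andP[t10 _] s1] := fs 1 ltr01; have [t2 /andP[t20 t21] s2] := fs t1 t10.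
  move: s1 s2; rewrite {1}sE {2}sE => /coneP[] // u1 _ /coneP[] // u2 _ /=.
  have -> : eta = (t1 - t2)^-1 *: ((x + t1 *: eta) - (x + t2 *: eta)).
    rewrite [x + t1 *: _]addrC addrKA -scalerBl scalerA mulVf ?scale1r //.
    by rewrite subr_eq0 gt_eqF.
  by rewrite memvZ ?memvB.
have cs : cells T (1 + d) s.
  by split=> //; rewrite sE; apply/has_lin_dim_cone.
exists s => //; apply/(cell_pos _ cs) => w wW.
have [|h _] := @freq_affine R (coef (g s) x w) (coef (g s) eta w); last exact: h.
move=> e e0; have [t te st] := fs e e0; exists t => //.
by move/(cell_pos _ cs): st => /(_ w wW); rewrite coefD coefZ.
Qed.

(** The functional cutting the common face out of [s] vanishes at [x], hence at [w], so [w] lies in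
    [t]. Likewise the generators of [t] occurring in [w] lie in [s]; since [w] is extremal in [s]
    they are multiples of it, and heights make them equal to it. *)
Lemma fan_face s t x w : cells T (1 + d) s -> cells T (1 + d) t ->
  s x -> t x -> w \in g s -> 0 < coef (g s) x w -> w \in g t.
Proof.
move=> cs ct sx tx wW cw; have [[_ _ _ inter _] _ _] := UT.
have [Ts _] := cs; have [Tt _] := ct.
have bW := cell_full cs; have bW' := cell_full ct.
have fW := full_free bW; have fW' := full_free bW'.
have sgen u : u \in g s -> s u.
  by move=> uW; apply/(cell_pos _ cs); apply: pos_gen.
have tgen u : u \in g t -> t u.
  by move=> uW; apply/(cell_pos _ ct); apply: pos_gen.
have [[u u0 uE] [u' u0' uE']] := inter s t Ts Tt.
(* A nonnegative combination killed by a face functional has all its positive terms in the face. *)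
have killed (X : seq V) (l : V) y r : (forall r, r \in X -> 0 <= dot l r) ->
    full_basis X -> pos X y -> dot l y = 0 -> r \in X -> 0 < coef X y r -> dot l r = 0.
  move=> l0 bX py ly rX cr; apply/eqP; rewrite eq_le l0 // andbT.
  move: ly; rewrite {1}(coefE y bX) dot_sum (big_rem r) //= dotZ => e.
  have : 0 <= \sum_(z <- rem r X) dot l (coef X y z *: z).
    by rewrite big_seq sumr_ge0 // => z /mem_rem zX; rewrite dotZ mulr_ge0 ?py ?l0.
  by move=> r0; rewrite -(pmulr_rle0 _ cr); lra.
have tw : t w.
  have /= : (s `&` t) w; last by case.
  rewrite uE; split; first exact: sgen.
  apply: (@killed (g s) u x) => //; first by move=> r /sgen/u0.
    exact/(cell_pos _ cs).
  by have : (s `&` t) x by []; rewrite uE => -[].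
have pw : pos (g t) w by apply/(cell_pos _ ct).
have in_s r : r \in g t -> 0 < coef (g t) w r -> s r.
  move=> rW cr; have /= : (s `&` t) r; last by case.
  rewrite uE'; split; first exact: tgen.
  apply: (@killed (g t) u' w) => //; first by move=> q /tgen/u0'.
  have : (s `&` t) w by split=> //; apply: sgen.
  by rewrite uE' => -[].
have [r rW cr] : exists2 r, r \in g t & coef (g t) w r != 0.
  apply/hasP; apply/negPn/negP => /hasPn h; have := free_not0 fW wW.
  rewrite (coefE w bW') big1_seq ?eqxx // => r /= rW.
  by have := h r rW; rewrite negbK => /eqP->; rewrite scale0r.
have cr0 : 0 < coef (g t) w r by rewrite lt0r cr pw.
suff rw : r = w by rewrite -rw.
have co_r q : q \in g s -> q != w -> coef (g s) r q = 0.
  move=> qW qw; have := coef_in fW wW qW; rewrite eq_sym (negPf qw).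
  rewrite {1}(coefE w bW') coef_sum (big_rem r) //= coefZ => e.
  have pr z : z \in g t -> 0 <= coef (g s) (coef (g t) w z *: z) q.
    move=> zW; rewrite coefZ; have [->|z0] := eqVneq (coef (g t) w z) 0; first by rewrite mul0r.
    rewrite mulr_ge0 ?pw //.
    have /(cell_pos _ cs) : s z by apply: in_s; rewrite // lt0r z0 pw.
    exact.
  have r0 : 0 <= \sum_(y <- rem r (g t)) coef (g s) (coef (g t) w y *: y) q.
    by rewrite big_seq sumr_ge0 // => z /mem_rem/pr.
  have := pr r rW; rewrite coefZ => p1.
  have /eqP : coef (g t) w r * coef (g s) r q = 0 by lra.
  by rewrite mulf_eq0 (negPf cr) => /eqP.
have rE : r = coef (g s) r w *: w.
  rewrite {1}(coefE r bW) (bigD1_seq w) ?full_uniq //= big1_seq ?addr0 // => q.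
  by move=> /andP[qw qW]; rewrite co_r // scale0r.
have h1 := hA_one height_one_lattice_points.
have := h1 _ (gen_lattice_point Tt rW).
rewrite rE first_coordZ (h1 _ (gen_lattice_point Ts wW)) mulr1 => ->.
by rewrite scale1r.
Qed.

(** On the cell [f] is linear. For [x] in [C], the interior point [p] lies on the segment from [x]
    to a point [p'] of the cell, so convexity bounds [f x] from below by the linear form of the
    cell. *)
Lemma fan_regular : exists f : V -> R, forall s, cells T (1 + d) s ->
  exists u : V, forall x, C x -> dot u x <= f x /\ (pos (g s) x <-> f x = dot u x).
Proof.
have [_ [f cf fE] _] := UT; exists f => s cs.
have [u sE] := fE s cs; exists u => x Cx.
have bW := cell_full cs; have fW := full_free bW.
split; last first.
  rewrite cell_pos //; split; first by rewrite sE => -[].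
  by move=> e; rewrite sE.
have sP y : pos (g s) y -> C y /\ f y = dot u y by rewrite cell_pos // {1}sE.
clear sE; pose p := \sum_(w <- g s) w.
have cop w : w \in g s -> coef (g s) p w = 1.
  by move=> wW; rewrite coef_sum_seq // count_uniq_mem ?full_uniq // wW.
have [e e0 he] : exists2 e : R, 0 < e &
    forall w, w \in g s -> 0 < 1 + e * (1 - coef (g s) x w).
  apply: small_ex; apply: small_all => w _.
  by apply: small_affine_gt0; exact: ltr01.
have pp : pos (g s) p by move=> w wW; rewrite cop.
pose p' := p + e *: (p - x).
have pp' : pos (g s) p'.
  by move=> w wW; rewrite coefD coefZ coefB cop //; apply/ltW/he.
(* The weight for which [p = a *: p' + (1 - a) *: x]. *)
pose a : R := (1 + e)^-1.
have a0 : 0 < a by rewrite invr_gt0; lra.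
have ae : a * (1 + e) = 1 by rewrite mulVf //; lra.
have a1 : a * e = 1 - a by move: ae; rewrite mulrDr mulr1; lra.
have a2 : 0 < 1 - a by rewrite -a1 mulr_gt0.
have a3 : a <= 1 by lra.
have [Cp fp] := sP p pp; have [Cp' fp'] := sP p' pp'.
have := cf (Itv01 (ltW a0) a3) p' x (mem_set Cp') (mem_set Cx).
have -> : conv (Itv01 (ltW a0) a3) (p' : convex_lmodType V) x = p.
  rewrite /conv /= /unstable.onem scalerDr scalerA a1 -addrA -scalerDr subrK.
  by rewrite -scalerDl addrC subrK scale1r.
rewrite convRE /= /unstable.onem fp fp' dotD dotZ.
have -> : dot u (p - x) = dot u p - dot u x.
  by rewrite dotD -scaleN1r dotZ mulN1r.
rewrite mulrDr mulrA a1 => h.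
by rewrite -(ler_pM2l a2); lra.
Qed.

Variable Ws : seq (seq V).
Hypothesis WsP : forall W, W \in Ws <-> exists2 s, cells T (1 + d) s & W = g s.

Lemma fan_triangulation : triangulation C lattice_points Ws.
Proof.
split.
- by move=> W /WsP[s cs ->]; apply: cell_full.
- by move=> W w /WsP[s [Ts _] ->]; apply: gen_lattice_point.
- move=> x /maximal_cover[s cs sx]; exists (g s); first by apply/WsP; exists s.
  exact/(cell_pos _ cs).
- move=> W W' x w /WsP[s cs ->] /WsP[t ct ->].
  by move=> /(cell_pos _ cs) sx /(cell_pos _ ct) tx; apply: fan_face.
- have [f hf] := fan_regular; exists f.
  have : forall W, exists u : V, W \in Ws -> forall x, C x ->
      dot u x <= f x /\ (pos W x <-> f x = dot u x).
    move=> W; have [WW|_] := boolP (W \in Ws); last by exists 0.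
    by have /WsP[s cs ->] := WW; have [u hu] := hf s cs; exists u.
  by move=> /choice[u hu]; exists u => x W Cx /hu; apply.
Qed.

Variable xi : V.
Hypothesis xiX : Xi C xi.

(** A vanishing coordinate at [w] would put [xi] in the span of the cone on the other generators,
    which is a face of the cell and so a [d]-dimensional cone of [T]. *)
Lemma Xi_gen : generic_in C Ws xi.
Proof.
have [Cxi gxi] := xiX; split=> // W w /WsP[s cs ->] wW.
apply/negP => /eqP c0; have [Ts _] := cs; have [fW sE _] := gP Ts.
have bW := cell_full cs.
pose X := [seq u <- g s | u != w].
have fX : free X by exact: filter_free.
have [[_ _ faceT _ _] _ _] := UT.
have TX : T (cone_hull [set` X]).
  by apply: (faceT s) => //; rewrite {1}sE; apply: (cone_face (fun u => u != w)).
apply: (gxi T UT (cone_hull [set` X])).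
  split=> //; apply/has_lin_dim_cone => //.
  by rewrite /X -rem_filter ?full_uniq // size_rem // full_size.
rewrite lin_span_cone //= (coefE xi bW) (bigD1_seq w) ?full_uniq //= c0 scale0r add0r.
rewrite -big_filter; rewrite big_seq; apply: memv_suml => u uX.
by apply/memvZ/memv_span.
Qed.

Lemma ray_combE s l : T s -> ray_comb s l = \sum_(w <- g s) l w *: w.
Proof.
move=> Ts; have [fW _ rE] := gP Ts.
by rewrite /ray_comb rE -fsbig_seq // free_uniq.
Qed.

Lemma neg_raysE s w : cells T (1 + d) s ->
  neg_rays xi s w <-> w \in g s /\ coef (g s) xi w < 0.
Proof.
move=> cs; have [Ts _] := cs; have [fW _ rE] := gP Ts; rewrite /neg_rays /= rE.
split=> [[/= wW [l]]|[wW cw]].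
  by rewrite ray_combE // => -> lw; rewrite coef_comb.
split=> //; exists (coef (g s) xi) => //; rewrite ray_combE //.
exact/coefE/cell_full.
Qed.

Lemma half_open_cellE s x : cells T (1 + d) s ->
  half_open_cell xi s x <-> in_half_open (g s) xi x.
Proof.
move=> cs; have [Ts _] := cs; have [fW _ rE] := gP Ts; split.
  move=> [m]; rewrite ray_combE // => -> [m0 mn] w wW; rewrite coef_comb //.
  split; first by apply: m0; rewrite rE.
  by move=> cw; apply: mn; apply/neg_raysE.
move=> hx; exists (coef (g s) x).
  by rewrite ray_combE //; apply/coefE/cell_full.
split; first by move=> w; rewrite rE => /hx[].
by move=> w /(neg_raysE _ cs)[/hx[_ h] /h].
Qed.

Lemma half_open_boxE s y : cells T (1 + d) s ->
  half_open_box xi s y <-> box (g s) xi y.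
Proof.
move=> cs; have [Ts _] := cs; have [fW _ rE] := gP Ts; split.
  move=> [m]; rewrite ray_combE // => -> [m0 mn] w wW; rewrite coef_comb //.
  case: ifP => cw; first by apply: mn; apply/neg_raysE.
  by apply: m0; [rewrite rE | move=> /(neg_raysE _ cs)[_]; rewrite cw].
move=> hy; exists (coef (g s) y).
  by rewrite ray_combE //; apply/coefE/cell_full.
split=> w.
  rewrite rE => wW nw; have := hy w wW; case: ifP => // cw.
  by case: nw; apply/(neg_raysE _ cs).
by move=> /(neg_raysE _ cs)[wW cw]; have := hy w wW; rewrite cw.
Qed.

Section Coset.
Variable Q : set V.
Hypothesis cQ : coset lattice_points Q.

(** Both uses of [xget] choose from nonempty sets, by [hopen_ex] and [dec_ex], so the chosen cell
    and box point have their defining properties. *)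
Lemma frac_part_decomposes x : C x -> Q x -> decomposes Ws xi (frac_part T xi x) x.
Proof.
move=> Cx Qx; set s := cell_of T xi x.
have [cs hs] : cells T (1 + d) s /\ half_open_cell xi s x.
  rewrite /s /cell_of; set S := (X in xget _ X).
  apply: (@xgetPex _ _ S); rewrite /S.
  have [W /WsP[t ct ->] ht] := hopen_ex conic_cone_over fan_triangulation Xi_gen Cx.
  by exists t; split=> //; apply/half_open_cellE.
have [Ts _] := cs.
have WW : g s \in Ws by apply/WsP; exists s.
move/(half_open_cellE _ cs): hs => hs.
have [y dy] := dec_ex (cell_full cs) hs.
exists (g s) => //; rewrite /frac_part -/s; set S := (X in xget _ X).
suff : S (xget 0 S).
  move=> [/(half_open_boxE _ cs) b _ [m]]; rewrite ray_combE // => e.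
  by split=> //; exists m; rewrite -e addrC subrK.
apply: xgetPex; exists y; split.
- by apply/half_open_boxE; case: dy.
- exact: coset_lattice cQ _ (dec_coset cQ fan_triangulation WW Qx dy).
- by case: dy => _ [m ->]; exists m; rewrite ray_combE // addrC addKr.
Qed.

(** A box point is its own fractional part, so every height of a box point in [Q] is attained. *)
Lemma hstar_image : hstar T xi @` (C `&` Q) = [set y | exists2 k : nat, y = k%:R & box_heights Q Ws xi k].
Proof.
have hA := height_one_lattice_points; have tW := fan_triangulation.
apply/seteqP; split=> y /=.
  move=> [x [Cx Qx] <-]; have dx := frac_part_decomposes Cx Qx.
  have [W WW d0] := dx; have b0 : box W xi (frac_part T xi x) by case: d0.
  have Q0 := dec_coset cQ tW WW Qx d0.
  have C0 : C (frac_part T xi x).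
    apply: (pos_cone conic_cone_over hA tW WW); apply: (@hopen_pos _ _ _ xi).
    exact: dec_hopen (tri_basis tW WW) (dec_refl b0).
  have [k hk] := height_nat hA cQ tW Q0 C0.
  by exists k; rewrite ?/hstar //; exists W, (frac_part T xi x).
move=> [k -> [W [z [WW bz Qz zk]]]].
have Cz : C z.
  apply: (pos_cone conic_cone_over hA tW WW); apply: (@hopen_pos _ _ _ xi).
  exact: dec_hopen (tri_basis tW WW) (dec_refl bz).
exists z => //; rewrite /hstar -zk; congr first_coord.
apply: (decomposes_uniq tW Xi_gen (frac_part_decomposes Cz Qz)).
by exists W => //; apply: dec_refl.
Qed.

End Coset.
End Fan.
End Polytope.

Theorem theorem4p7 (R : realType) (d : nat) (P : set 'rV[R]_d)
    (P_lattice : lattice_polytope P) (P_dim : has_aff_dim P d)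
    (v : 'rV[R]_(1 + d)) (v_lattice : lattice v) :
  exists a b : nat, (a <= b)%N /\
    forall (T0 : set (set 'rV[R]_(1 + d))) (xi0 : 'rV[R]_(1 + d)),
      Upsilon (cone_over P) T0 -> Xi (cone_over P) xi0 ->
      [set y : R | a%:R <= y <= b%:R /\ y \is a Num.int] =
      hstar T0 xi0 @` (cone_over P `&` [set v + g | g in Gamma P]).
Proof.
have cC := conic_cone_over P; have hA := height_one_lattice_points P.
have cQ := coset_Gamma P v_lattice.
set Q := [set v + g | g in Gamma P] in cQ *.
have Qv : Q v.
  by exists 0; rewrite ?addr0 //; exists 0%N, (fun=> 0), (fun=> 0); split=> [[]|] //;
    rewrite big_ord0.
have triT T : Upsilon (cone_over P) T -> exists Ws,
    triangulation (cone_over P) (lattice_points P) Ws /\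
    forall xi, Xi (cone_over P) xi -> generic_in (cone_over P) Ws xi /\
      hstar T xi @` (cone_over P `&` Q) = [set y | exists2 k : nat, y = k%:R & box_heights Q Ws xi k].
  move=> UT; have [g gP] := fan_gens UT; have [Ws WsP] := maximal_cells UT g.
  exists Ws; split; first exact: (fan_triangulation P_lattice P_dim UT gP WsP).
  move=> xi xiX; split; first exact: (Xi_gen UT gP WsP xiX).
  exact: (hstar_image P_lattice P_dim UT gP WsP xiX cQ).
(* Without any triangulation the claim is vacuous, and both bounds are set to 0. *)
have [[T1 UT1]|noT] := pselect (exists T, Upsilon (cone_over P) T); last first.
  by exists 0%N, 0%N; split=> // T0 xi0 U0; case: noT; exists T0.
have [Ws1 [tW1 _]] := triT T1 UT1.
have [a [b [ab hab]]] := is_height_interval cC hA cQ tW1 Qv.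
exists a, b; split=> // T0 xi0 UT0 Xxi0.
have [Ws0 [tW0 /(_ _ Xxi0) [g0 ->]]] := triT T0 UT0.
have [xi1 gxi1] := gen_ex cC hA tW1.
(* The bounds were read off from [T1] alone; [hts_independent] carries them over to the given
   pair. *)
have hE k : box_heights Q Ws0 xi0 k <-> (a <= k <= b)%N.
  rewrite -hab; split=> [h|[xi gxi h]].
    by exists xi1 => //; apply/(hts_independent cC hA cQ tW0 tW1 g0 gxi1).
  by apply/(hts_independent cC hA cQ tW0 tW1 g0 gxi).
apply/seteqP; split=> y /=.
  move=> [/andP[ay yb] yint].
  have /natrP[k yk] : y \is a Num.nat.
    by rewrite Num.Theory.natrEint yint (le_trans _ ay) // ler0n.
  exists k => //; apply/hE; move: ay yb; rewrite yk !ler_nat.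
  by move=> -> ->.
move=> [k -> /hE /andP[ak kb]]; by rewrite !ler_nat ak kb; split.
Qed.
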